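(* Linearizable $4$-webs in the plane exist, and the general solution of the system of differential equations defining such webs (the system written out in the context) depends on four arbitrary functions of one variable.
   Context: Let $M^2$ be a two-dimensional analytic manifold. A $4$-web $W$ is given in an open domain $D\subset M^2$ by four foliations $X_1,X_2,X_3,X_4$ of curves such that the tangents to the curves of different foliations through any point of $D$ are distinct, and two curves of different foliations have at most one common point in $D$. All functions and forms are real of class $C^\infty$ (or holomorphic in the complex case). The foliation $X_\alpha$, $\alpha=1,2,3$, is defined by $\omega_\alpha=0$, where the $1$-forms are normalized so that $\omega_1+\omega_2+\omega_3=0$. There is a unique $1$-form $\theta$ with $d\omega_\alpha=\omega_\alpha\wedge\theta$, and the curvature $K$ of the $3$-subweb $[1,2,3]$ is defined by $d\theta=K\,\omega_1\wedge\omega_2$. The foliation $X_4$ is defined by $\omega_4=0$, $-\omega_4=a\omega_1+\omega_2$, where $a\neq0,1$ is the basic invariant. Covariant derivatives are defined by $$dK-2K\theta=K_1\omega_1+K_2\omega_2,\qquad da=a_1\omega_1+a_2\omega_2,$$ $$da_1-a_1\theta=a_{11}\omega_1+a_{12}\omega_2,\qquad da_2-a_2\theta=a_{12}\omega_1+a_{22}\omega_2,$$ $$da_{11}-2a_{11}\theta=a_{111}\omega_1+(a_{112}+\tfrac23a_1K)\omega_2,$$ $$da_{12}-2a_{12}\theta=(a_{112}-\tfrac13a_1K)\omega_1+(a_{122}+\tfrac13a_2K)\omega_2,$$ $$da_{22}-2a_{22}\theta=(a_{122}-\tfrac23a_2K)\omega_1+a_{222}\omega_2.$$ A $4$-web is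 linear if it is formed by four foliations of straight lines, and linearizable if it is equivalent (under a diffeomorphism of the web domains carrying foliation $X_c$ to foliation $\widetilde X_c$, $c=1,\dots,4$) to a linear $4$-web. By the known criterion of Akivis, Goldberg and Lychagin, $W$ is linearizable if and only if $$\begin{aligned}K_1={}&\frac{1}{a-a^2}\Bigl[\tfrac13\bigl(a_1(1-a)+aa_2\bigr)K-a_{111}+(2+a)a_{112}-2aa_{122}\Bigr]\\ &+\frac{1}{(a-a^2)^2}\Bigl\{\bigl[(4-6a)a_1+(-2+3a+a^2)a_2\bigr]a_{11}+\bigl[(-6+7a+2a^2)a_1+(2a-3a^2)a_2\bigr]a_{12}\\ &\qquad+\bigl[2a(1-a)a_1-2a^2a_2\bigr]a_{22}\Bigr\}\\ &+\frac{1}{(a-a^2)^3}\Bigl\{(-3+8a-6a^2)a_1^3-2a^3a_2^3+(6-15a+9a^2+2a^3)a_1^2a_2+(-2a+6a^2-3a^3)a_1a_2^2\Bigr\},\end{aligned}$$ $$\begin{aligned}K_2={}&\frac{1}{a-a^2}\Bigl[\tfrac13\bigl(a_1+a_2(a-1)\bigr)K+2a_{112}-(2a+1)a_{122}+aa_{222}\Bigr]\\ &+\frac{1}{(a-a^2)^2}\Bigl\{\bigl[2a_1+(2a-2)a_2\bigr]a_{11}+\bigl[(-5+6a)a_1+(2-3a-2a^2)a_2\bigr]a_{12}\\ &\qquad+\bigl[(1-a-2a^2)a_1+2a^2a_2\bigr]a_{22}\Bigr\}\\ &+\frac{1}{(a-a^2)^3}\Bigl\{(4a-2)a_1^3+a^3a_2^3+(5-12a+6a^2)a_1^2a_2+(-2+5a-3a^2-2a^3)a_1a_2^2\Bigr\}.\end{aligned}$$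 The system defining linearizable $4$-webs is the exterior differential system consisting of the structure equations $d\omega_\alpha=\omega_\alpha\wedge\theta$, $d\theta=K\omega_1\wedge\omega_2$, the Pfaffian equations for $da$, $da_i$, $da_{ij}$ above, and the Pfaffian equation $dK-2K\theta=K_1\omega_1+K_2\omega_2$ with $K_1,K_2$ replaced by these two expressions. ''Depends on $k$ functions of $m$ variables'' is meant in the sense of Cartan's theory of exterior differential systems in involution (the last nonzero Cartan character is $s_m=k$). *)

(* Defs.v *)
From HB Require Import structures.
From mathcomp Require Import all_boot all_order all_algebra.
From mathcomp Require Import all_classical all_reals all_analysis.
From mathcomp Require Import complex.
From Stdlib Require Import Relation_Operators.

Set Implicit Arguments.
Unset Strict Implicit.
Unset Printing Implicit Defensive.

Import Order.TTheory GRing.Theory Num.Theory.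
Import numFieldNormedType.Exports.
Local Open Scope classical_set_scope.
Local Open Scope ring_scope.

(** * Four-webs in the plane and their linearizability *)

(* The scalar field K is R or R[i]. *)
Section Webs.
Context {K : numFieldType}.

Fixpoint class_C {V W : normedModType K} (k : nat) (U : set V) (f : V -> W)
    : Prop :=
  if k is k'.+1 then
    (forall p, U p -> differentiable f p) /\
    (forall v, class_C k' U ('D_v f))
  else forall p, U p -> {for p, continuous f}.

(* C^oo on an open set U; over R[i] this means holomorphic. *)
Definition smooth {V W : normedModType K} (U : set V) (f : V -> W) : Prop :=
  forall k, class_C k U f.

Definition plane := 'rV[K]_2.

(* A foliation of curves is given by an atlas of pairs (U, u), u being a
   submersion on the open set U; the plaques are the level sets of u in U. *)
Definition foliation_atlas := set (set plane * (plane -> K)).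

Definition is_foliation (D : set plane) (A : foliation_atlas) : Prop :=
  [/\ forall U u, A (U, u) ->
        [/\ open U, U `<=` D, smooth U u,
            forall p, U p -> exists v, 'd u p v != 0 &
            forall c : K, connected (U `&` u @^-1` [set c])],
      forall p, D p -> exists U u, A (U, u) /\ U p &
      forall U u U' u' p, A (U, u) -> A (U', u') -> U p -> U' p ->
        forall v, 'd u p v = 0 <-> 'd u' p v = 0].

Definition tangent_line (A : foliation_atlas) (p : plane) : set plane :=
  [set v | exists U u, [/\ A (U, u), U p & 'd u p v = 0]].

Definition same_plaque (A : foliation_atlas) (p q : plane) : Prop :=
  exists U u, [/\ A (U, u), U p, U q & u p = u q].

(* The leaf (curve of the foliation) through p consists of the points reached
   from p by finite chains of plaques. *)
Definition leaf (A : foliation_atlas) (p : plane) : set plane :=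
  [set q | clos_refl_trans plane (same_plaque A) p q].

Definition four_web (D : set plane) (X : 'I_4 -> foliation_atlas) : Prop :=
  [/\ [/\ open D, connected D & D !=set0],
      forall c, is_foliation D (X c),
      forall c c' p, c != c' -> D p ->
        tangent_line (X c) p <> tangent_line (X c') p &
      forall c c' p p', c != c' -> D p -> D p' ->
        is_subset1 (leaf (X c) p `&` leaf (X c') p')].

Definition straight_line (p v : plane) : set plane :=
  [set q | exists t : K, q = p + t *: v].

Definition linear_web (D : set plane) (X : 'I_4 -> foliation_atlas) : Prop :=
  four_web D X /\
  forall c p, D p -> exists2 v, v != 0 & leaf (X c) p `<=` straight_line p v.

Definition diffeomorphism (D D' : set plane) (phi : plane -> plane) : Prop :=
  [/\ smooth D phi, set_bij D D' phi &
      exists psi : plane -> plane,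
        smooth D' psi /\ forall p, D p -> psi (phi p) = p].

Definition equivalent_webs (D : set plane) (X : 'I_4 -> foliation_atlas)
    (D' : set plane) (X' : 'I_4 -> foliation_atlas) : Prop :=
  exists2 phi, diffeomorphism D D' phi &
    forall c p, D p -> phi @` leaf (X c) p = leaf (X' c) (phi p).

Definition linearizable (D : set plane) (X : 'I_4 -> foliation_atlas) : Prop :=
  exists D' X', linear_web D' X' /\ equivalent_webs D X D' X'.

End Webs.

Arguments plane K : clear implicits.
Arguments foliation_atlas K : clear implicits.

(** * Exterior differential systems with structure equations *)

(* The unknowns are a coframe e^1, ..., e^n of an n-dimensional manifold
   satisfying prescribed structure equations, and m functions z_1, ..., z_m on
   that manifold satisfying Pfaffian equations Theta_1 = ... = Theta_r = 0.
   All forms are written in the coframe (e^1, ..., e^n, dz_1, ..., dz_m), with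
   coefficients depending on z.  At a given z, a tangent vector and a 1-form
   are rows of length n + m (of components, resp. of coefficients), and a
   2-form is the alternating matrix O with O(u, v) = u O v^T. *)
Section CartanSystems.
Context {K : numFieldType} {n m r : nat}.

Definition form1 := 'rV[K]_m -> 'rV[K]_(n + m).
Definition form2 := 'rV[K]_m -> 'M[K]_(n + m).

Definition wedge (al be : 'rV[K]_(n + m)) : 'M[K]_(n + m) :=
  al^T *m be - be^T *m al.

Definition eval1 (al u : 'rV[K]_(n + m)) : K := (u *m al^T) 0 0.

Definition eval2 (O : 'M[K]_(n + m)) (u v : 'rV[K]_(n + m)) : K :=
  (u *m O *m v^T) 0 0.

(* (al /\ O)(u, v, w) for a 1-form al and a 2-form O *)
Definition wedge12 (al : 'rV[K]_(n + m)) (O : 'M[K]_(n + m))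
    (u v w : 'rV[K]_(n + m)) : K :=
  eval1 al u * eval2 O v w + eval1 al v * eval2 O w u + eval1 al w * eval2 O u v.

Definition base_form (i : 'I_n) : 'rV[K]_(n + m) := row_mx (delta_mx 0 i) 0.
Definition coord_form (j : 'I_m) : 'rV[K]_(n + m) := row_mx 0 (delta_mx 0 j).

Record cartan_system := CartanSystem {
  domain : set 'rV[K]_m;
  structure_form : 'I_n -> form2;     (* de^i = structure_form i *)
  pfaffian_form : 'I_r -> form1       (* Theta_i = pfaffian_form i *)
}.

Variable S : cartan_system.

Definition d_fun (f : 'rV[K]_m -> K) (z : 'rV[K]_m) : 'rV[K]_(n + m) :=
  \sum_(j < m) 'D_(delta_mx 0 j) f z *: coord_form j.

Definition d_coframe (k : 'I_(n + m)) : form2 :=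
  match fintype.split k with
  | inl i => structure_form S i
  | inr _ => fun _ => 0
  end.

(* d(sum_k f_k e^k) = sum_k (df_k /\ e^k + f_k de^k) *)
Definition d_form1 (al : form1) : form2 := fun z =>
  \sum_(k < n + m) (wedge (d_fun (fun y => al y 0 k) z) (delta_mx 0 k)
                    + al z 0 k *: d_coframe k z).

(* d(1/2 sum O_ij e^i /\ e^j), using
   d(e^i /\ e^j) = e^j /\ de^i - e^i /\ de^j *)
Definition d_form2 (O : form2) (z : 'rV[K]_m) (u v w : 'rV[K]_(n + m)) : K :=
  2^-1 * \sum_(i < n + m) \sum_(j < n + m)
    (wedge12 (d_fun (fun y => O y i j) z)
             (wedge (delta_mx 0 i) (delta_mx 0 j)) u v w
     + O z i j * (wedge12 (delta_mx 0 j) (d_coframe i z) u v w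
                  - wedge12 (delta_mx 0 i) (d_coframe j z) u v w)).

(* The identities d(de^i) = 0 are consequences of the system: each d(de^i)
   lies in the ideal generated by the Theta_j and dTheta_j.  (They need not hold
   identically: the structure functions may depend on the unknowns z.) *)
Definition structure_closed (z : 'rV[K]_m) : Prop :=
  forall i : 'I_n, exists la : 'I_r -> 'rV[K]_(n + m),
  forall u v w : 'rV[K]_(n + m),
    (forall j, [/\ eval1 (pfaffian_form S j z) u = 0,
                   eval1 (pfaffian_form S j z) v = 0 &
                   eval1 (pfaffian_form S j z) w = 0]) ->
    d_form2 (structure_form S i) z u v w
    = \sum_(j < r) wedge12 (la j) (d_form1 (pfaffian_form S j) z) u v w.

(* A subspace of tangent vectors is given as the row space of E. *)
Definition integral_element (z : 'rV[K]_m) k (E : 'M[K]_(k, n + m)) : Prop :=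
  forall j, E *m (pfaffian_form S j z)^T = 0 /\
            E *m d_form1 (pfaffian_form S j) z *m E^T = 0.

(* The polar equations of E: the 1-forms Theta_j and e _| dTheta_j, e in E.
   The polar space of E is their common kernel, of codimension polar_rank. *)
Definition polar_equations (z : 'rV[K]_m) k (E : 'M[K]_(k, n + m))
    : 'M[K]_(n + m) :=
  (\sum_(j < r) <<pfaffian_form S j z>>
   + \sum_(j < r) <<E *m d_form1 (pfaffian_form S j) z>>)%MS.

Definition polar_rank (z : 'rV[K]_m) k (E : 'M[K]_(k, n + m)) : nat :=
  \rank (polar_equations z E).

(* An n-dimensional integral element with e^1 /\ ... /\ e^n <> 0, represented
   by its unique basis B_1, ..., B_n with e^i(B_j) = delta_ij. *)
Definition admissible (z : 'rV[K]_m) (B : 'M[K]_(n, n + m)) : Prop :=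
  lsubmx B = 1%:M /\ integral_element z B.

(* c is the polar rank of a generic (i.e. the maximal polar rank of a)
   k-dimensional subspace of an admissible integral element. *)
Definition generic_polar_rank (z : 'rV[K]_m) (k c : nat) : Prop :=
  (exists (B : 'M[K]_(n, n + m)) (F : 'M[K]_(k, n)),
     [/\ admissible z B, \rank F = k & polar_rank z (F *m B) = c]) /\
  (forall (B : 'M[K]_(n, n + m)) (F : 'M[K]_(k, n)),
     admissible z B -> \rank F = k -> (polar_rank z (F *m B) <= c)%N).

(* s_0 + ... + s_k = c_k for k < n, and s_0 + ... + s_n = (n + m) - n. *)
Definition cartan_characters (z : 'rV[K]_m) (s : nat -> nat) : Prop :=
  (forall k, (k < n)%N -> generic_polar_rank z k (\sum_(i < k.+1) s i)) /\
  (\sum_(i < n.+1) s i = m)%N.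

(* The admissible integral elements at z form a nonempty affine space of
   dimension N. *)
Definition integral_elements_dim (z : 'rV[K]_m) (N : nat) : Prop :=
  exists (B0 : 'M[K]_(n, n + m)) (L : {vspace 'M[K]_(n, n + m)}),
    (\dim L = N)%N /\ forall B, admissible z B <-> B - B0 \in L.

(* Involution at z, by Cartan's test: N = s_1 + 2 s_2 + ... + n s_n. *)
Definition involutive_with_characters (z : 'rV[K]_m) (s : nat -> nat) : Prop :=
  [/\ structure_closed z, cartan_characters z s &
      integral_elements_dim z (\sum_(k < n.+1) k * s k)].

(* The general solution depends on k functions of q variables. *)
Definition general_solution_depends_on (k q : nat) : Prop :=
  exists s : nat -> nat,
    (forall z, domain S z -> involutive_with_characters z s) /\
    [/\ (0 < q <= n)%N, s q = k, (0 < k)%N &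
        forall j, (q < j <= n)%N -> s j = 0%N].

End CartanSystems.

Arguments form1 K n m : clear implicits.
Arguments form2 K n m : clear implicits.
Arguments cartan_system K n m r : clear implicits.

(** * The system defining linearizable 4-webs *)

Section LinearizableSystem.
Context {K : numFieldType}.

Definition K1_expr (a a1 a2 a11 a12 a22 k a111 a112 a122 : K) : K :=
  1 / (a - a ^+ 2) *
    (3^-1 * (a1 * (1 - a) + a * a2) * k - a111 + (2 + a) * a112 - 2 * a * a122)
  + 1 / (a - a ^+ 2) ^+ 2 *
    (((4 - 6 * a) * a1 + (- 2 + 3 * a + a ^+ 2) * a2) * a11
     + ((- 6 + 7 * a + 2 * a ^+ 2) * a1 + (2 * a - 3 * a ^+ 2) * a2) * a12
     + (2 * a * (1 - a) * a1 - 2 * a ^+ 2 * a2) * a22)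
  + 1 / (a - a ^+ 2) ^+ 3 *
    ((- 3 + 8 * a - 6 * a ^+ 2) * a1 ^+ 3 - 2 * a ^+ 3 * a2 ^+ 3
     + (6 - 15 * a + 9 * a ^+ 2 + 2 * a ^+ 3) * a1 ^+ 2 * a2
     + (- 2 * a + 6 * a ^+ 2 - 3 * a ^+ 3) * a1 * a2 ^+ 2).

Definition K2_expr (a a1 a2 a11 a12 a22 k a112 a122 a222 : K) : K :=
  1 / (a - a ^+ 2) *
    (3^-1 * (a1 + a2 * (a - 1)) * k + 2 * a112 - (2 * a + 1) * a122 + a * a222)
  + 1 / (a - a ^+ 2) ^+ 2 *
    ((2 * a1 + (2 * a - 2) * a2) * a11
     + ((- 5 + 6 * a) * a1 + (2 - 3 * a - 2 * a ^+ 2) * a2) * a12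
     + ((1 - a - 2 * a ^+ 2) * a1 + 2 * a ^+ 2 * a2) * a22)
  + 1 / (a - a ^+ 2) ^+ 3 *
    ((4 * a - 2) * a1 ^+ 3 + a ^+ 3 * a2 ^+ 3
     + (5 - 12 * a + 6 * a ^+ 2) * a1 ^+ 2 * a2
     + (- 2 + 5 * a - 3 * a ^+ 2 - 2 * a ^+ 3) * a1 * a2 ^+ 2).

(* The coframe (omega_1, omega_2, theta) lives on the 3-dimensional bundle of
   the coframes (omega_1, omega_2) normalized by omega_1 + omega_2 + omega_3 = 0,
   which is unique up to a common factor.  The equation
   d omega_3 = omega_3 /\ theta is the sum of the other two. *)
Definition om1 : 'rV[K]_(3 + 11) := base_form (@Ordinal 3 0 isT).
Definition om2 : 'rV[K]_(3 + 11) := base_form (@Ordinal 3 1 isT).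
Definition theta : 'rV[K]_(3 + 11) := base_form (@Ordinal 3 2 isT).

(* The unknown functions z_0, ..., z_10 are, in this order,
   a, a_1, a_2, a_11, a_12, a_22, K, a_111, a_112, a_122, a_222. *)
Definition i_a : 'I_11 := @Ordinal 11 0 isT.
Definition i_a1 : 'I_11 := @Ordinal 11 1 isT.
Definition i_a2 : 'I_11 := @Ordinal 11 2 isT.
Definition i_a11 : 'I_11 := @Ordinal 11 3 isT.
Definition i_a12 : 'I_11 := @Ordinal 11 4 isT.
Definition i_a22 : 'I_11 := @Ordinal 11 5 isT.
Definition i_K : 'I_11 := @Ordinal 11 6 isT.
Definition i_a111 : 'I_11 := @Ordinal 11 7 isT.
Definition i_a112 : 'I_11 := @Ordinal 11 8 isT.
Definition i_a122 : 'I_11 := @Ordinal 11 9 isT.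
Definition i_a222 : 'I_11 := @Ordinal 11 10 isT.

Definition web_domain : set 'rV[K]_11 :=
  [set z | z 0 i_a != 0 /\ z 0 i_a != 1].

Definition web_structure_form (i : 'I_3) : form2 K 3 11 := fun z =>
  [:: wedge om1 theta; wedge om2 theta; z 0 i_K *: wedge om1 om2]`_i.

Definition web_pfaffian_form (i : 'I_7) : form1 K 3 11 := fun z =>
  let a := z 0 i_a in
  let a1 := z 0 i_a1 in let a2 := z 0 i_a2 in
  let a11 := z 0 i_a11 in let a12 := z 0 i_a12 in let a22 := z 0 i_a22 in
  let k := z 0 i_K in
  let a111 := z 0 i_a111 in let a112 := z 0 i_a112 in
  let a122 := z 0 i_a122 in let a222 := z 0 i_a222 in
  [:: coord_form i_a - (a1 *: om1 + a2 *: om2);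
      coord_form i_a1 - a1 *: theta - (a11 *: om1 + a12 *: om2);
      coord_form i_a2 - a2 *: theta - (a12 *: om1 + a22 *: om2);
      coord_form i_a11 - (2 * a11) *: theta
        - (a111 *: om1 + (a112 + 2 / 3 * a1 * k) *: om2);
      coord_form i_a12 - (2 * a12) *: theta
        - ((a112 - 1 / 3 * a1 * k) *: om1 + (a122 + 1 / 3 * a2 * k) *: om2);
      coord_form i_a22 - (2 * a22) *: theta
        - ((a122 - 2 / 3 * a2 * k) *: om1 + a222 *: om2);
      coord_form i_K - (2 * k) *: theta
        - (K1_expr a a1 a2 a11 a12 a22 k a111 a112 a122 *: om1
           + K2_expr a a1 a2 a11 a12 a22 k a112 a122 a222 *: om2)]`_i.

Definition linearizable_web_system : cartan_system K 3 11 7 :=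
  CartanSystem web_domain web_structure_form web_pfaffian_form.

End LinearizableSystem.

Arguments linearizable_web_system K : clear implicits.

(* Main.v *)
From HB Require Import structures.
Require Import Defs.
From mathcomp Require Import all_boot all_order all_algebra.
From mathcomp Require Import all_classical all_reals all_analysis.
From mathcomp Require Import complex ring.
From Stdlib Require Import Relation_Operators.

(* Modulo the Pfaffian equations, only the derivatives of a_111, a_112, a_122
   and a_222 along an integral element are free.  Their theta-components are
   fixed, consistently because K_1 and K_2 are homogeneous of weight 3 when a,
   a_i, a_ij, K, a_ijk have weights 0, 1, 2, 2, 3.  Their eight omega-components
   satisfy four independent linear equations, which are solvable whatever the
   lower-order terms of K_1 and K_2 are: there is no torsion, and integral
   elements form a 4-dimensional affine space.  The polar equations of
   omega_1 = x, omega_2 = y in these four unknowns have determinant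
   3 x y (x + y) (a x + y) / (a - a^2), up to sign, so a direction is regular as
   soon as it is tangent to no foliation of the web.  Hence
   (s_0, s_1, s_2, s_3) = (7, 4, 0, 0), and Cartan's test holds. *)

Set Implicit Arguments.
Unset Strict Implicit.
Unset Printing Implicit Defensive.

Import Order.TTheory GRing.Theory Num.Theory.
Import numFieldNormedType.Exports.
Local Open Scope classical_set_scope.
Local Open Scope ring_scope.

(** * Differential calculus and exterior forms *)

Section HasDiff.
Context {K : numFieldType} {V : normedModType K} (z w : V).
Implicit Types (f g : V -> K).

(** Differentiability and the value of the differential along [w] travel together, so one structural
    pass over a rational expression yields both. *)
Definition has_diff f d := differentiable f z /\ 'd f z w = d.

Lemma has_diff_cst c : has_diff (fun=> c) 0.
Proof.
split; first exact: differentiable_cst.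
by have /= -> := congr1 (fun h => h w) (diff_cst c z).
Qed.

Lemma has_diffD f g d e :
  has_diff f d -> has_diff g e -> has_diff (fun y => f y + g y) (d + e).
Proof.
move=> [df <-] [dg <-]; split; first exact: differentiableD.
by rewrite -[fun y => _]/(f + g) diffD.
Qed.

Lemma has_diffN f d : has_diff f d -> has_diff (fun y => - f y) (- d).
Proof.
move=> [df <-]; split; first exact: differentiableN.
by rewrite -[fun y => _]/(- f) diffN.
Qed.

Lemma has_diffM f g d e :
  has_diff f d -> has_diff g e ->
  has_diff (fun y => f y * g y) (f z * e + g z * d).
Proof.
move=> [df <-] [dg <-]; split; first exact: differentiableM.
by rewrite -[fun y => _]/(f * g) diffM.
Qed.

Lemma has_diffX f d k :
  has_diff f d -> has_diff (fun y => f y ^+ k.+1) (k.+1%:R * f z ^+ k * d).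
Proof.
move=> fd; elim: k => [|k IH]; first by rewrite expr0 !mul1r.
have -> : (fun y => f y ^+ k.+2) = fun y => f y * f y ^+ k.+1.
  by apply/funext => y; rewrite exprS.
suff -> : k.+2%:R * f z ^+ k.+1 * d =
  f z * (k.+1%:R * f z ^+ k * d) + f z ^+ k.+1 * d by exact: has_diffM.
by rewrite exprS -[k.+2]addn1 natrD; ring.
Qed.

Lemma has_diffV f d : f z != 0 ->
  has_diff f d -> has_diff (fun y => (f y)^-1) (- (f z ^+ 2)^-1 * d).
Proof.
move=> fz [df <-]; split; first exact: differentiableV.
by rewrite -[fun y => _]/(fun y => (f y)^-1) diffV.
Qed.

End HasDiff.

Lemma diff_valD (K : numFieldType) (V W : normedModType K) (f : V -> W) z v w :
  'd f z (v + w) = 'd f z v + 'd f z w.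
Proof. exact: linearD. Qed.

Lemma has_diff_coord (K : numFieldType) m (z w : 'rV[K]_m) i :
  has_diff z w (fun y : 'rV[K]_m => y 0 i) (w 0 i).
Proof.
split; first exact: differentiable_coord.
have lin : linear (fun y : 'rV[K]_m => y 0 i) by move=> c x y; rewrite !mxE.
pose linM := GRing.isLinear.Build _ _ _ _ _ lin.
pose f : {linear 'rV[K]_m -> K} := HB.pack (fun y : 'rV[K]_m => y 0 i) linM.
by have /= -> := diff_lin z (@coord_continuous _ _ _ 0 i : continuous f).
Qed.

(** * Evaluation of forms and of exterior derivatives on vectors *)

Section Eval.
Context {K : numFieldType} {n m r : nat}.
Implicit Types (u v w : 'rV[K]_(n + m)) (al be : 'rV[K]_(n + m)) (O : 'M[K]_(n + m)).

Lemma eval1E al u : eval1 al u = \sum_k u 0 k * al 0 k.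
Proof. by rewrite /eval1 mxE; apply: eq_bigr => k _; rewrite mxE. Qed.

Lemma eval1_delta k u : eval1 (delta_mx 0 k) u = u 0 k.
Proof.
rewrite eval1E (bigD1 k) //= big1 ?addr0 ?mxE ?eqxx ?mulr1// => i ik.
by rewrite mxE eqxx (negbTE ik) mulr0.
Qed.

Lemma eval1Zl c al u : eval1 (c *: al) u = c * eval1 al u.
Proof. by rewrite /eval1 linearZ -scalemxAr mxE. Qed.

Lemma eval1_0l u : eval1 0 u = 0.
Proof. by rewrite /eval1 trmx0 mulmx0 mxE. Qed.

Lemma eval2D O O' u v : eval2 (O + O') u v = eval2 O u v + eval2 O' u v.
Proof. by rewrite /eval2 mulmxDr mulmxDl mxE. Qed.

Lemma eval2Z c O u v : eval2 (c *: O) u v = c * eval2 O u v.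
Proof. by rewrite /eval2 -scalemxAr -scalemxAl mxE. Qed.

Lemma eval2_0 u v : eval2 0 u v = 0.
Proof. by rewrite /eval2 mulmx0 mul0mx mxE. Qed.

Lemma eval2_sum (I : finType) (F : I -> 'M[K]_(n + m)) u v :
  eval2 (\sum_i F i) u v = \sum_i eval2 (F i) u v.
Proof. by rewrite /eval2 mulmx_sumr mulmx_suml summxE. Qed.

Lemma eval1C al u : eval1 al u = eval1 u al.
Proof. by rewrite !eval1E; apply: eq_bigr => k _; rewrite mulrC. Qed.

Lemma eval2_wedge al be u v :
  eval2 (wedge al be) u v = eval1 al u * eval1 be v - eval1 al v * eval1 be u.
Proof.
rewrite /eval2 /wedge mulmxBr mulmxBl !mulmxA -!(mulmxA _ _ v^T) !mxE !big_ord1.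
by rewrite -!/(eval1 _ _) (eval1C v be) (eval1C v al) [X in _ - X]mulrC.
Qed.

Lemma eval1_d_fun (f : 'rV[K]_m -> K) z u : differentiable f z ->
  eval1 (d_fun f z : 'rV[K]_(n + m)) u = 'd f z (rsubmx u).
Proof.
move=> df; rewrite /d_fun /eval1 linear_sum /= mulmx_sumr summxE.
rewrite [in RHS](row_sum_delta (rsubmx u)) linear_sum /=; apply: eq_bigr => j _.
rewrite linearZ /= -scalemxAr mxE linearZ /= deriveE //.
rewrite mulrC; congr (_ * _).
rewrite -[in LHS](hsubmxK u) /coord_form -/(eval1 _ _) eval1E big_split_ord /=.
rewrite big1 ?add0r => [|i _]; last by rewrite !row_mxEl [X in _ * X]mxE mulr0.
rewrite (bigD1 j) //= !row_mxEr [delta_mx _ _ _ _]mxE !eqxx mulr1 big1 ?addr0 //.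
by move=> i ij; rewrite !row_mxEr [delta_mx _ _ _ _]mxE (negbTE ij) andbF mulr0.
Qed.

Lemma d_fun_cst (c : K) z : d_fun (fun=> c) z = 0 :> 'rV[K]_(n + m).
Proof.
rewrite /d_fun big1 // => j _.
by rewrite (_ : (fun=> c) = cst c) // derive_cst scale0r.
Qed.

Variable S : @cartan_system K n m r.

Lemma eval2_d_form1 (al : form1 K n m) z u v :
  (forall k, differentiable (fun y => al y 0 k) z) ->
  eval2 (d_form1 S al z) u v =
  \sum_k ('d (fun y => al y 0 k) z (rsubmx u) * v 0 k
          - 'd (fun y => al y 0 k) z (rsubmx v) * u 0 k
          + al z 0 k * eval2 (d_coframe S k z) u v).
Proof.
move=> dal; rewrite /d_form1 eval2_sum; apply: eq_bigr => k _.
by rewrite eval2D eval2Z eval2_wedge !eval1_delta !eval1_d_fun.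
Qed.

End Eval.

(** * Exterior derivative of a 2-form with a single term *)

Section DForm2.
Context {K : numFieldType} {n m r : nat} (S : @cartan_system K n m r).

Lemma d_coframe_lshift i : d_coframe S (lshift m i) = structure_form S i.
Proof. by rewrite /d_coframe (unsplitK (inl i)). Qed.

Lemma d_coframe_rshift j : d_coframe S (rshift n j) = fun=> 0.
Proof. by rewrite /d_coframe (unsplitK (inr j)). Qed.

Lemma wedgeC (al be : 'rV[K]_(n + m)) : wedge be al = - wedge al be.
Proof. by rewrite /wedge opprB. Qed.

Lemma wedge12N (al : 'rV[K]_(n + m)) O u v w :
  wedge12 al (- O) u v w = - wedge12 al O u v w.
Proof. by rewrite /wedge12 -scaleN1r !eval2Z; ring. Qed.

Lemma wedge12Zl c (al : 'rV[K]_(n + m)) O u v w :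
  wedge12 (c *: al) O u v w = c * wedge12 al O u v w.
Proof. by rewrite /wedge12 !eval1Zl; ring. Qed.

(** In the half-sum of [d_form2], the alternating matrix can be nonzero only at [(a, b)] and
    [(b, a)]. Both entries contribute the same amount, since [G] changes sign when its indices are
    exchanged, and this absorbs the factor 1/2. *)
Lemma d_form2_monomial (O : form2 K n m) (f : 'rV[K]_m -> K) a b z u v w :
  differentiable f z ->
  (forall y, O y = f y *: wedge (delta_mx 0 a) (delta_mx 0 b)) ->
  d_form2 S O z u v w =
  wedge12 (d_fun f z) (wedge (delta_mx 0 a) (delta_mx 0 b)) u v w
  + f z * (wedge12 (delta_mx 0 b) (d_coframe S a z) u v w
           - wedge12 (delta_mx 0 a) (d_coframe S b z) u v w).
Proof.
move=> df OE; set W := wedge _ _ in OE *.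
pose G i j :=
  wedge12 (d_fun f z) (wedge (delta_mx 0 i) (delta_mx 0 j)) u v w
  + f z * (wedge12 (delta_mx 0 j) (d_coframe S i z) u v w
           - wedge12 (delta_mx 0 i) (d_coframe S j z) u v w).
rewrite -/(G a b).
have GN i j : G j i = - G i j by rewrite /G wedgeC wedge12N; ring.
have WE i j : W i j = (i == a)%:R * (j == b)%:R - (i == b)%:R * (j == a)%:R.
  by rewrite /W /wedge !mxE !big_ord1 !mxE !eqxx /=.
have dE i j : d_fun (fun y => O y i j) z = W i j *: d_fun f z.
  rewrite /d_fun scaler_sumr; apply: eq_bigr => k _; rewrite scalerA.
  congr (_ *: _); have -> : (fun y => O y i j) = W i j \*: f.
    by apply/funext => y; rewrite OE mxE mulrC.
  by rewrite deriveZ //; exact: diff_derivable.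
have OzE i j : O z i j = f z * W i j by rewrite OE mxE.
have pick (H : 'I_(n + m) -> 'I_(n + m) -> K) a' b' :
    \sum_i \sum_j (i == a')%:R * (j == b')%:R * H i j = H a' b'.
  rewrite (bigD1 a') //= [X in _ + X]big1 => [|i /negbTE ia].
    rewrite addr0 (bigD1 b') //= big1 => [|j /negbTE jb].
      by rewrite !eqxx !mul1r addr0.
    by rewrite jb mulr0 mul0r.
  by rewrite big1 // => j _; rewrite ia !mul0r.
rewrite /d_form2.
transitivity (2^-1 * (\sum_i \sum_j (i == a)%:R * (j == b)%:R * G i j
   - \sum_i \sum_j (i == b)%:R * (j == a)%:R * G i j)).
  congr (_ * _); rewrite -sumrB; apply: eq_bigr => i _; rewrite -sumrB.
  apply: eq_bigr => j _; rewrite dE wedge12Zl OzE WE /G; ring.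
by rewrite !pick GN; field.
Qed.

End DForm2.

(** * Integral elements, polar equations and rank bounds *)

Lemma mulmx_form1_eq0 (K : numFieldType) n m k (E : 'M[K]_(k, n + m)) al :
  E *m al^T = 0 <-> forall i, eval1 al (row i E) = 0.
Proof.
rewrite /eval1; split => [E0 i|E0]; first by rewrite -row_mul E0 !mxE.
apply/matrixP => i j; have := E0 i.
by rewrite -row_mul mxE (ord1 j) => ->; rewrite mxE.
Qed.

Lemma mulmx_form2E (K : numFieldType) n m k l (E : 'M[K]_(k, n + m)) O
    (F : 'M[K]_(l, n + m)) i j :
  (E *m O *m F^T) i j = eval2 O (row i E) (row j F).
Proof. by rewrite /eval2 tr_row -!row_mul colE mulmxA -colE !mxE. Qed.

(** [P] maps the kernel of [A] injectively into a space of dimension [d]. Polar ranks are bounded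
    below this way. *)
Lemma mxrank_ge_inj (F : fieldType) m n d (A : 'M[F]_(m, n)) (P : 'M[F]_(n, d)) :
  (forall x : 'rV_n, A *m x^T = 0 -> x *m P = 0 -> x = 0) ->
  (n <= \rank A + d)%N.
Proof.
move=> inj; pose N := kermx A^T.
have cap0 : (N :&: kermx P)%MS = 0.
  apply/row_matrixP => i; rewrite row0.
  have := row_sub i (N :&: kermx P)%MS; rewrite sub_capmx.
  case/andP => /sub_kermxP xA /sub_kermxP xP; apply: inj xP.
  by rewrite -[A]trmxK -trmx_mul xA trmx0.
have := mxrank_mul_ker N P; rewrite cap0 mxrank0 addn0 mxrank_ker mxrank_tr => e.
by have := rank_leq_col (N *m P); rewrite e leq_subLR.
Qed.

Section Polar.
Context {K : numFieldType} {n m r : nat} (S : @cartan_system K n m r).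

Lemma polar_equations_ker z k (E : 'M[K]_(k, n + m)) (x : 'rV[K]_(n + m)) :
  polar_equations S z E *m x^T = 0 -> forall j,
  eval1 (pfaffian_form S j z) x = 0 /\
  forall i, eval2 (d_form1 S (pfaffian_form S j) z) (row i E) x = 0.
Proof.
move=> Ax j; have Ax' p (u : 'M[K]_(p, n + m)) :
    (u <= polar_equations S z E)%MS -> u *m x^T = 0.
  by case/submxP => D ->; rewrite -mulmxA Ax mulmx0.
split=> [|i].
  rewrite eval1C /eval1 Ax' ?mxE // /polar_equations.
  apply: submx_trans (addsmxSl _ _); apply: (sumsmx_sup j) => //.
  by rewrite genmxE.
rewrite /eval2 -row_mul -row_mul Ax' ?row0 ?mxE // /polar_equations.
apply: submx_trans (addsmxSr _ _); apply: (sumsmx_sup j) => //.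
by rewrite genmxE.
Qed.

(** An integral element lies in the polar space of each of its subspaces. It has dimension [n], so
    the polar space has codimension at most [(n + m) - n]. *)
Lemma polar_rank_max z k (B : 'M[K]_(n, n + m)) (F : 'M[K]_(k, n)) :
  admissible S z B -> (polar_rank S z (F *m B) <= m)%N.
Proof.
case=> B1 BI; rewrite /polar_rank; set A := polar_equations _ _ _.
have AB : A *m B^T = 0.
  apply/sub_kermxP; rewrite /A /polar_equations addsmx_sub.
  apply/andP; split; apply/sumsmx_subP => j _; rewrite genmxE; apply/sub_kermxP.
    by rewrite -[LHS]trmxK trmx_mul trmxK (BI j).1 trmx0.
  by rewrite -!mulmxA (mulmxA B) (BI j).2 mulmx0.
have rB : \rank B = n.
  apply/eqP; apply/row_freeP; exists (col_mx 1%:M 0).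
  by rewrite -[B]hsubmxK mul_row_col B1 mulmx1 mulmx0 addr0.
by have := mulmx0_rank_max AB; rewrite mxrank_tr rB addnC leq_add2l.
Qed.

(** The zero element contributes no contraction of a dTheta_j; only the [r] forms Theta_j remain. *)
Lemma polar_rank0_max z (E : 'M[K]_(0, n + m)) : (polar_rank S z E <= r)%N.
Proof.
rewrite /polar_rank /polar_equations; apply: leq_trans (mxrank_adds_leqif _ _).1 _.
have E0 (F : 'M[K]_(0, n + m)) : F = 0 by apply/matrixP => -[].
rewrite [X in (_ + X)%N](_ : _ = 0%N) ?addn0.
  apply: leq_trans (mxrank_sum_leqif _).1 _ => /=.
  rewrite -[X in (_ <= X)%N]card_ord -sum1_card.
  by apply: leq_sum => j _; rewrite mxrank_gen rank_leq_row.
by rewrite big1 ?mxrank0 // => j _; rewrite (E0 (_ *m _)) genmx0.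
Qed.

End Polar.

(** * The system of linearizable webs *)

(** Differentiates along the syntax of the function; the goals left open are the nonvanishing of
    denominators. *)
Ltac has_diff_tac :=
  first [ exact: has_diff_cst | exact: has_diff_coord
        | apply: has_diffD; has_diff_tac | apply: has_diffN; has_diff_tac
        | apply: has_diffM; has_diff_tac | apply: has_diffX; has_diff_tac
        | apply: has_diffV; [ | has_diff_tac ] ].

Lemma has_diff_eq (K : numFieldType) (V : normedModType K) (z w : V) f d d' :
  has_diff z w f d -> d = d' -> has_diff z w f d'.
Proof. by move=> fd <-. Qed.

Lemma ord11P (P : 'I_11 -> Prop) :
  P i_a -> P i_a1 -> P i_a2 -> P i_a11 -> P i_a12 -> P i_a22 -> P i_K ->
  P i_a111 -> P i_a112 -> P i_a122 -> P i_a222 -> forall i, P i.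
Proof.
move=> h0 h1 h2 h3 h4 h5 h6 h7 h8 h9 h10 [i lti].
do 11?[case: i lti => [lti|i lti];
  first by match goal with h : P ?x |- _ =>
    rewrite (_ : Ordinal _ = x) //; exact: val_inj end].
by [].
Qed.

(** * Coefficients of the Pfaffian forms and their differentials *)

Section System.
Context {K : numFieldType}.
Implicit Types (z w : 'rV[K]_11).

(* Theta_j = dz_j - sum_k coef j k e^k, with (e^0, e^1, e^2) = (om1, om2, theta). *)
Definition coef (j k : nat) z : K :=
  let a := z 0 i_a in
  let a1 := z 0 i_a1 in let a2 := z 0 i_a2 in
  let a11 := z 0 i_a11 in let a12 := z 0 i_a12 in let a22 := z 0 i_a22 in
  let b := z 0 i_K in
  let a111 := z 0 i_a111 in let a112 := z 0 i_a112 in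
  let a122 := z 0 i_a122 in let a222 := z 0 i_a222 in
  nth 0 (nth [::]
    [:: [:: a1; a2; 0];
        [:: a11; a12; a1];
        [:: a12; a22; a2];
        [:: a111; a112 + 2 / 3 * a1 * b; 2 * a11];
        [:: a112 - 1 / 3 * a1 * b; a122 + 1 / 3 * a2 * b; 2 * a12];
        [:: a122 - 2 / 3 * a2 * b; a222; 2 * a22];
        [:: K1_expr a a1 a2 a11 a12 a22 b a111 a112 a122;
            K2_expr a a1 a2 a11 a12 a22 b a112 a122 a222; 2 * b]] j) k.

(** The Pfaffian forms are solved for the differentials of the first seven unknowns, one each;
    [inord] only embeds the index into the eleven unknowns. *)
Lemma web_pfaffian_formE (j : 'I_7) z :
  web_pfaffian_form j z =
  row_mx (- \row_(k < 3) coef j k z) (delta_mx 0 (@inord 10 j)).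
Proof.
have E (j' : 'I_11) (x y t : K) :
    coord_form j' - t *: theta - (x *: om1 + y *: om2) =
    row_mx (- \row_(k < 3) nth 0 [:: x; y; t] k) (delta_mx 0 j').
  rewrite /coord_form /theta /om1 /om2 /base_form !scale_row_mx !opp_row_mx.
  rewrite !add_row_mx !opp_row_mx !add_row_mx !scaler0 !addr0 !subr0.
  congr row_mx; apply/rowP => -[[|[|[|//]]] ltk]; rewrite !mxE /=; ring.
have E0 (j' : 'I_11) (x y : K) :
    coord_form j' - (x *: om1 + y *: om2) =
    row_mx (- \row_(k < 3) nth 0 [:: x; y; 0] k) (delta_mx 0 j').
  by rewrite -E scale0r subr0.
case: j => -[|[|[|[|[|[|[|//]]]]]]] ltj; rewrite /web_pfaffian_form /= ?E ?E0;
  by congr row_mx; congr delta_mx; apply/val_inj; rewrite /= inordK.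
Qed.

(** The differentials of [K1_expr] and [K2_expr] stay unexpanded: only their linearity and their
    values on free and Euler directions are used. *)
Definition dcoef6 (k : nat) z w : K := 'd (coef 6 k) z w.

Definition dcoef (j k : nat) z w : K :=
  let a1 := z 0 i_a1 in let a2 := z 0 i_a2 in let b := z 0 i_K in
  nth 0 (nth [::]
    [:: [:: w 0 i_a1; w 0 i_a2; 0];
        [:: w 0 i_a11; w 0 i_a12; w 0 i_a1];
        [:: w 0 i_a12; w 0 i_a22; w 0 i_a2];
        [:: w 0 i_a111; w 0 i_a112 + 2 / 3 * (a1 * w 0 i_K + b * w 0 i_a1);
            2 * w 0 i_a11];
        [:: w 0 i_a112 - 1 / 3 * (a1 * w 0 i_K + b * w 0 i_a1);
            w 0 i_a122 + 1 / 3 * (a2 * w 0 i_K + b * w 0 i_a2);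
            2 * w 0 i_a12];
        [:: w 0 i_a122 - 2 / 3 * (a2 * w 0 i_K + b * w 0 i_a2);
            w 0 i_a222; 2 * w 0 i_a22];
        [:: dcoef6 0 z w; dcoef6 1 z w; 2 * w 0 i_K]] j) k.

(* Only the third-order unknowns a_111, a_112, a_122, a_222 vary. *)
Definition free_direction w :=
  [/\ w 0 i_a = 0, w 0 i_a1 = 0 & w 0 i_a2 = 0] /\
  [/\ w 0 i_a11 = 0, w 0 i_a12 = 0, w 0 i_a22 = 0 & w 0 i_K = 0].

Lemma domain_neq0 z : web_domain z -> z 0 i_a - z 0 i_a ^+ 2 != 0.
Proof.
case=> a0 a1; rewrite (_ : _ - _ = z 0 i_a * (1 - z 0 i_a)); last by ring.
by rewrite mulf_neq0 // subr_eq0 eq_sym.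
Qed.

(** K_1 is affine in the third-order unknowns, with coefficients depending on a alone, so no
    lower-order term survives. *)
Lemma K1_free z w : web_domain z -> free_direction w ->
  has_diff z w (coef 6 0)
   ((- w 0 i_a111 + (2 + z 0 i_a) * w 0 i_a112 - 2 * z 0 i_a * w 0 i_a122)
    / (z 0 i_a - z 0 i_a ^+ 2)).
Proof.
move=> /domain_neq0 z0 [[w0 w1 w2] [w3 w4 w5 w6]].
rewrite /coef /= /K1_expr; apply: has_diff_eq.
  has_diff_tac => //; by rewrite expf_neq0.
by rewrite w0 w1 w2 w3 w4 w5 w6; field.
Qed.

Lemma K2_free z w : web_domain z -> free_direction w ->
  has_diff z w (coef 6 1)
   ((2 * w 0 i_a112 - (2 * z 0 i_a + 1) * w 0 i_a122 + z 0 i_a * w 0 i_a222)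
    / (z 0 i_a - z 0 i_a ^+ 2)).
Proof.
move=> /domain_neq0 z0 [[w0 w1 w2] [w3 w4 w5 w6]].
rewrite /coef /= /K2_expr; apply: has_diff_eq.
  has_diff_tac => //; by rewrite expf_neq0.
by rewrite w0 w1 w2 w3 w4 w5 w6; field.
Qed.

(* The generator of the scalings under which K_1 and K_2 are homogeneous of
   weight 3. *)
Definition euler_direction z w :=
  [/\ w 0 i_a = 0, w 0 i_a1 = z 0 i_a1, w 0 i_a2 = z 0 i_a2 &
   w 0 i_a11 = 2 * z 0 i_a11] /\
  [/\ w 0 i_a12 = 2 * z 0 i_a12, w 0 i_a22 = 2 * z 0 i_a22 &
   w 0 i_K = 2 * z 0 i_K] /\
  [/\ w 0 i_a111 = 3 * z 0 i_a111, w 0 i_a112 = 3 * z 0 i_a112,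
   w 0 i_a122 = 3 * z 0 i_a122 & w 0 i_a222 = 3 * z 0 i_a222].

Lemma K1_euler z w : web_domain z -> euler_direction z w ->
  has_diff z w (coef 6 0) (3 * coef 6 0 z).
Proof.
move=> /domain_neq0 z0 [[w0 w1 w2 w3] [[w4 w5 w6] [w7 w8 w9 w10]]].
rewrite /coef /= /K1_expr; apply: has_diff_eq.
  has_diff_tac => //; by rewrite expf_neq0.
rewrite w0 w1 w2 w3 w4 w5 w6 w7 w8 w9.
by field.
Qed.

Lemma K2_euler z w : web_domain z -> euler_direction z w ->
  has_diff z w (coef 6 1) (3 * coef 6 1 z).
Proof.
move=> /domain_neq0 z0 [[w0 w1 w2 w3] [[w4 w5 w6] [w7 w8 w9 w10]]].
rewrite /coef /= /K2_expr; apply: has_diff_eq.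
  has_diff_tac => //; by rewrite expf_neq0.
rewrite w0 w1 w2 w3 w4 w5 w6 w8 w9 w10.
by field.
Qed.

Lemma free_direction0 : free_direction 0.
Proof. by rewrite /free_direction !mxE. Qed.

Lemma has_diff_coef (j : 'I_7) (k : 'I_3) z w : web_domain z ->
  has_diff z w (coef j k) (dcoef j k z w).
Proof.
(* For the entries given by [K1_expr] and [K2_expr] the value holds by definition of [dcoef6]; the
   zero free direction supplies differentiability. *)
move=> zD; have [d1 _] := K1_free zD free_direction0.
have [d2 _] := K2_free zD free_direction0.
case: j => -[|[|[|[|[|[|[|//]]]]]]] ltj; case: k => -[|[|[|//]]] ltk;
  rewrite /dcoef /=; first [by split | rewrite /coef /=; apply: has_diff_eq;
    [has_diff_tac | by rewrite /=; field]].
Qed.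

End System.

(* Otherwise unification unfolds these rational functions when it compares
   [coef 6 0] with [coef 6 1]. *)
Local Opaque K1_expr K2_expr.

Lemma sum_ord3 (V : nmodType) (F : 'I_3 -> V) :
  \sum_k F k = F (@Ordinal 3 0 isT) + F (@Ordinal 3 1 isT) + F (@Ordinal 3 2 isT).
Proof.
rewrite !big_ord_recl big_ord0 addr0 addrA.
by congr (F _ + F _ + F _); exact: val_inj.
Qed.

(** * Theta_j and dTheta_j on vectors; closure of the structure equations *)

Section Web.
Context {K : numFieldType}.
Implicit Types (z w : 'rV[K]_11) (u v : 'rV[K]_(3 + 11)).
Notation S := (linearizable_web_system K).
Local Notation "x `0" := (lsubmx x 0 (@Ordinal 3 0 isT)) (at level 2).
Local Notation "x `1" := (lsubmx x 0 (@Ordinal 3 1 isT)) (at level 2).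
Local Notation "x `2" := (lsubmx x 0 (@Ordinal 3 2 isT)) (at level 2).

Lemma eval_base (k : 'I_3) u : eval1 (base_form k) u = lsubmx u 0 k.
Proof.
rewrite /base_form (_ : row_mx _ _ = delta_mx 0 (lshift 11 k)) ?eval1_delta ?mxE//.
by rewrite delta_mx_lshift.
Qed.

Lemma eval_theta (j : 'I_7) z u : eval1 (pfaffian_form S j z) u =
  rsubmx u 0 (@inord 10 j)
  - (coef j 0 z * u `0 + coef j 1 z * u `1 + coef j 2 z * u `2).
Proof.
rewrite -[in LHS](hsubmxK u) [pfaffian_form _ _ _]web_pfaffian_formE.
rewrite eval1E big_split_ord sum_ord3 /= !row_mxEl !mxE /=.
rewrite (bigD1 (@inord 10 j)) //= !row_mxEr !mxE !eqxx mulr1 big1.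
  by ring.
by move=> i /negbTE ij; rewrite !row_mxEr !mxE ij mulr0.
Qed.

Lemma eval_web_structure z u v :
  [/\ eval2 (web_structure_form (@Ordinal 3 0 isT) z) u v =
      u`0 * v`2 - v`0 * u`2,
      eval2 (web_structure_form (@Ordinal 3 1 isT) z) u v =
      u`1 * v`2 - v`1 * u`2 &
      eval2 (web_structure_form (@Ordinal 3 2 isT) z) u v =
      z 0 i_K * (u`0 * v`1 - v`0 * u`1)].
Proof.
by rewrite /web_structure_form /= eval2Z !eval2_wedge !eval_base.
Qed.

(** The dz-part of Theta_j is constant, so dTheta_j is minus the sum over k of d(coef j k) /\ e^k +
    coef j k de^k. *)
Lemma eval_dtheta (j : 'I_7) z u v : web_domain z ->
  eval2 (d_form1 S (pfaffian_form S j) z) u v =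
    (dcoef j 0 z (rsubmx v) * u`0 - dcoef j 0 z (rsubmx u) * v`0)
  + (dcoef j 1 z (rsubmx v) * u`1 - dcoef j 1 z (rsubmx u) * v`1)
  + (dcoef j 2 z (rsubmx v) * u`2 - dcoef j 2 z (rsubmx u) * v`2)
  - (coef j 0 z * (u`0 * v`2 - v`0 * u`2)
     + coef j 1 z * (u`1 * v`2 - v`1 * u`2)
     + coef j 2 z * (z 0 i_K * (u`0 * v`1 - v`0 * u`1))).
Proof.
move=> zD.
have El k : (fun y => pfaffian_form S j y 0 (lshift 11 k)) = (fun y => - coef j k y).
  by apply/funext => y; rewrite [pfaffian_form _ _ _]web_pfaffian_formE row_mxEl !mxE.
have Er k : (fun y => pfaffian_form S j y 0 (rshift 3 k)) =
    (fun=> (k == @inord 10 j)%:R).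
  by apply/funext => y; rewrite [pfaffian_form _ _ _]web_pfaffian_formE row_mxEr !mxE.
have dl k w : has_diff z w (fun y => pfaffian_form S j y 0 (lshift 11 k))
                           (- dcoef j k z w).
  by rewrite El; apply/has_diffN/has_diff_coef.
have dr k w : has_diff z w (fun y => pfaffian_form S j y 0 (rshift 3 k)) 0.
  by rewrite Er; exact: has_diff_cst.
rewrite eval2_d_form1; last first.
  by move=> k; case: (split_ordP k) => k' ->; [case: (dl k' 0)|case: (dr k' 0)].
rewrite big_split_ord /= [X in _ + X]big1 => [|k _]; last first.
  rewrite (dr k (rsubmx u)).2 (dr k (rsubmx v)).2 d_coframe_rshift eval2_0.
  by rewrite mulr0 !mul0r subr0 addr0.
have Z k : pfaffian_form S j z 0 (lshift 11 k) = - coef j k z.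
  exact: (congr1 (fun h => h z) (El k)).
have L (x : 'rV[K]_(3 + 11)) k : x 0 (lshift 11 k) = lsubmx x 0 k by rewrite mxE.
transitivity (\sum_(k < 3) (dcoef j k z (rsubmx v) * lsubmx u 0 k
    - dcoef j k z (rsubmx u) * lsubmx v 0 k
    - coef j k z * eval2 (web_structure_form k z) u v) + 0).
  congr (_ + 0); apply: eq_bigr => k _.
  by rewrite (dl k (rsubmx u)).2 (dl k (rsubmx v)).2 d_coframe_lshift Z !L /=; ring.
have [S0 S1 S2] := eval_web_structure z u v.
by rewrite sum_ord3 S0 S1 S2 /=; ring.
Qed.

(** The first two structure forms are closed by the structure equations alone. For K om1 /\ om2, the
    equation Theta_6 = 0 replaces dK: its om1 and om2 terms die against om1 /\ om2, and 2 K theta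
    cancels the contribution of d om1 and d om2. So all multipliers of the dTheta_j can be taken
    zero. *)
Lemma web_structure_closed z : structure_closed S z.
Proof.
move=> i; exists (fun=> 0) => u v w UVW.
rewrite [RHS]big1 => [|j _]; last by rewrite /wedge12 !eval1_0l; ring.
have base k : base_form k = delta_mx 0 (lshift 11 k) :> 'rV[K]_(3 + 11).
  by rewrite delta_mx_lshift.
have dc k : d_coframe S (lshift 11 k) z = web_structure_form k z.
  by rewrite d_coframe_lshift.
pose o0 := @Ordinal 3 0 isT; pose o1 := @Ordinal 3 1 isT.
pose o2 := @Ordinal 3 2 isT.
have dF (f : 'rV[K]_11 -> K) a b : differentiable f z ->
    (forall y, structure_form S i y = f y *: wedge (base_form a) (base_form b)) ->
    d_form2 S (structure_form S i) z u v w =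
    wedge12 (d_fun f z) (wedge (base_form a) (base_form b)) u v w
    + f z * (wedge12 (base_form b) (web_structure_form a z) u v w
             - wedge12 (base_form a) (web_structure_form b z) u v w).
  move=> df; rewrite !base => OE.
  by rewrite (d_form2_monomial _ _ _ _ df OE) !dc.
have [S0vw S1vw S2vw] := eval_web_structure z v w.
have [S0wu S1wu S2wu] := eval_web_structure z w u.
have [S0uv S1uv S2uv] := eval_web_structure z u v.
have coord : differentiable (fun y : 'rV[K]_11 => y 0 i_K) z.
  exact: differentiable_coord.
case: i dF => -[|[|[|//]]] lti dF.
- rewrite (dF (fun=> 1) o0 o2) => [||y]; last by rewrite scale1r.
    rewrite d_fun_cst /wedge12 !eval1_0l !eval_base S0vw S0wu S0uv S2vw S2wu S2uv.
    by ring.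
  exact: differentiable_cst.
- rewrite (dF (fun=> 1) o1 o2) => [||y]; last by rewrite scale1r.
    rewrite d_fun_cst /wedge12 !eval1_0l !eval_base S1vw S1wu S1uv S2vw S2wu S2uv.
    by ring.
  exact: differentiable_cst.
- rewrite (dF _ o0 o1 coord) // /wedge12 !eval1_d_fun //.
  rewrite S0vw S0wu S0uv S1vw S1wu S1uv !eval2_wedge !eval_base.
  have dK x : eval1 (pfaffian_form S (@Ordinal 7 6 isT) z) x = 0 ->
      'd (fun y : 'rV[K]_11 => y 0 i_K) z (rsubmx x) =
      coef 6 0 z * x`0 + coef 6 1 z * x`1 + 2 * z 0 i_K * x`2.
    move=> /eqP; rewrite eval_theta subr_eq0 (has_diff_coord z (rsubmx x) i_K).2.
    by move=> /eqP <-; congr (rsubmx x 0 _); apply/val_inj; rewrite /= inordK.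
  have [/dK -> /dK -> /dK ->] := UVW (@Ordinal 7 6 isT).
  by ring.
Qed.

End Web.

(** * Equations of the admissible integral elements *)

Section Admissible.
Context {K : numFieldType}.
Implicit Types (z v w : 'rV[K]_11).
Notation S := (linearizable_web_system K).
Notation o0 := (@Ordinal 3 0 isT).
Notation o1 := (@Ordinal 3 1 isT).
Notation o2 := (@Ordinal 3 2 isT).

(* The dz-part of the k-th vector of an admissible basis: Theta = 0 fixes all but
   the last four components, which are listed in q. *)
Definition velocity z (k : nat) (q : seq K) : 'rV[K]_11 :=
  \row_j nth 0 ([:: coef 0 k z; coef 1 k z; coef 2 k z; coef 3 k z;
                    coef 4 k z; coef 5 k z; coef 6 k z] ++ q) j.

(** Once the base part is the identity, Theta_j fixes one velocity component of each row, and the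
    alternating 3 by 3 matrix of dTheta_j amounts, up to sign, to its entries above the diagonal. *)
Lemma integral_elementP z (B : 'M[K]_(3, 3 + 11)) : web_domain z ->
  lsubmx B = 1%:M ->
  let b k := row k (rsubmx B) in
  integral_element S z B <->
  forall j : 'I_7,
  [/\ b o0 0 (@inord 10 j) = coef j 0 z,
      b o1 0 (@inord 10 j) = coef j 1 z & b o2 0 (@inord 10 j) = coef j 2 z] /\
  [/\ dcoef j 1 z (b o0) - dcoef j 0 z (b o1) + z 0 i_K * coef j 2 z = 0,
      dcoef j 2 z (b o0) - dcoef j 0 z (b o2) + coef j 0 z = 0 &
      dcoef j 2 z (b o1) - dcoef j 1 z (b o2) + coef j 1 z = 0].
Proof.
move=> zD B1 b.
have bE k : row k B = row_mx (delta_mx 0 k) (b k).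
  rewrite -[in LHS](hsubmxK B) B1 row_row_mx; congr row_mx.
  by rewrite row1.
have th k j : eval1 (pfaffian_form S j z) (row k B) =
    b k 0 (@inord 10 j) - coef j k z.
  rewrite eval_theta bE row_mxKl row_mxKr !mxE.
  by case: k => -[|[|[|//]]] ltk /=; ring.
have Bform k i j : (B *m d_form1 S (pfaffian_form S j) z *m B^T) k i =
    eval2 (d_form1 S (pfaffian_form S j) z) (row k B) (row i B).
  by rewrite mulmx_form2E.
have eq0_opp x y : x = 0 -> y = - x -> y = 0 :> K by move=> -> ->; rewrite oppr0.
have eq0_eq x y : x = 0 -> y = x -> y = 0 :> K by move=> -> ->.
split=> [BI j|BI j].
  have [/mulmx_form1_eq0 BI1 /matrixP BI2] := BI j.
  split; first by split; apply/eqP; rewrite -subr_eq0 -th BI1.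
  have := BI2 o0 o1; rewrite Bform eval_dtheta // !bE !row_mxKl !row_mxKr !mxE /=.
  have := BI2 o0 o2; rewrite Bform eval_dtheta // !bE !row_mxKl !row_mxKr !mxE /=.
  have := BI2 o1 o2; rewrite Bform eval_dtheta // !bE !row_mxKl !row_mxKr !mxE /=.
  move=> e1 e2 e3; split;
    [apply: (eq0_opp _ _ e3)|apply: (eq0_opp _ _ e2)|apply: (eq0_opp _ _ e1)];
    by ring.
have [[t0 t1 t2] [d01 d02 d12]] := BI j; split.
  apply/mulmx_form1_eq0 => k; rewrite th.
  case: k => -[|[|[|//]]] ltk /=.
  - by apply/eqP; rewrite subr_eq0 -t0; apply/eqP; congr (b _ 0 _); apply/val_inj.
  - by apply/eqP; rewrite subr_eq0 -t1; apply/eqP; congr (b _ 0 _); apply/val_inj.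
  - by apply/eqP; rewrite subr_eq0 -t2; apply/eqP; congr (b _ 0 _); apply/val_inj.
apply/matrixP => k i; rewrite Bform eval_dtheta // !bE !row_mxKl !row_mxKr !mxE.
have ord3 (l : 'I_3) : [\/ l = o0, l = o1 | l = o2].
  case: l => -[|[|[|//]]] ltl; [constructor 1|constructor 2|constructor 3];
  exact/val_inj.
by case: (ord3 k) => ->; case: (ord3 i) => -> /=; first [ring
  | by apply: (eq0_opp _ _ d01); ring | by apply: (eq0_opp _ _ d02); ring
  | by apply: (eq0_opp _ _ d12); ring | by apply: (eq0_eq _ _ d01); ring
  | by apply: (eq0_eq _ _ d02); ring | by apply: (eq0_eq _ _ d12); ring].
Qed.

Lemma dcoef6_split k z v w :
  dcoef6 k z v = dcoef6 k z w + dcoef6 k z (v - w).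
Proof. by rewrite -[in LHS](subrK w v) addrC; exact: diff_valD. Qed.

Lemma dcoef6_free z w : web_domain z -> free_direction w ->
  dcoef6 0 z w =
    (- w 0 i_a111 + (2 + z 0 i_a) * w 0 i_a112 - 2 * z 0 i_a * w 0 i_a122)
    / (z 0 i_a - z 0 i_a ^+ 2) /\
  dcoef6 1 z w =
    (2 * w 0 i_a112 - (2 * z 0 i_a + 1) * w 0 i_a122 + z 0 i_a * w 0 i_a222)
    / (z 0 i_a - z 0 i_a ^+ 2).
Proof.
by move=> zD wF; split; [exact: (K1_free zD wF).2|exact: (K2_free zD wF).2].
Qed.

Lemma dcoef6_euler z w : web_domain z -> euler_direction z w ->
  dcoef6 0 z w = 3 * coef 6 0 z /\ dcoef6 1 z w = 3 * coef 6 1 z.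
Proof.
by move=> zD wF; split; [exact: (K1_euler zD wF).2|exact: (K2_euler zD wF).2].
Qed.

Local Opaque dcoef6.

(** With an empty list the default of [nth] makes the third-order components zero, so the two
    velocities differ by a free direction. *)
Lemma dcoef6_velocity z k (q1 q2 q3 q4 : K) : web_domain z ->
  dcoef6 0 z (velocity z k [:: q1; q2; q3; q4]) =
    dcoef6 0 z (velocity z k [::])
    + (- q1 + (2 + z 0 i_a) * q2 - 2 * z 0 i_a * q3) / (z 0 i_a - z 0 i_a ^+ 2)
  /\
  dcoef6 1 z (velocity z k [:: q1; q2; q3; q4]) =
    dcoef6 1 z (velocity z k [::])
    + (2 * q2 - (2 * z 0 i_a + 1) * q3 + z 0 i_a * q4) / (z 0 i_a - z 0 i_a ^+ 2).
Proof.
move=> zD; set v := velocity _ _ _; set v0 := velocity _ _ _.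
have free : free_direction (v - v0) by rewrite /free_direction !mxE /= !subrr.
rewrite (dcoef6_split 0 z v v0) (dcoef6_split 1 z v v0).
by have [-> ->] := dcoef6_free zD free; rewrite !mxE /= !subr0.
Qed.

Definition frame_matrix z (q : seq (seq K)) : 'M[K]_(3, 3 + 11) :=
  row_mx 1%:M (\matrix_(k < 3) velocity z k (nth [::] q k)).

(* The inhomogeneous terms of the equations dTheta_j(B_0, B_1) = 0, j = 3, ..., 6,
   in the unknown derivatives of a_111, a_112, a_122, a_222; [torsion] is what
   remains once the first three equations are substituted in the last one. *)
Definition torsion3 z :=
  2 / 3 * (z 0 i_a11 * z 0 i_K + z 0 i_a1 * coef 6 0 z) + 2 * z 0 i_K * z 0 i_a11.

Definition torsion4 z :=
  1 / 3 * (z 0 i_a12 * z 0 i_K + z 0 i_a2 * coef 6 0 z)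
  + 1 / 3 * (z 0 i_a12 * z 0 i_K + z 0 i_a1 * coef 6 1 z) + 2 * z 0 i_K * z 0 i_a12.

Definition torsion5 z :=
  2 / 3 * (z 0 i_a22 * z 0 i_K + z 0 i_a2 * coef 6 1 z) + 2 * z 0 i_K * z 0 i_a22.

Definition torsion6 z := (z 0 i_a - z 0 i_a ^+ 2) *
  (dcoef6 1 z (velocity z 0 [::]) - dcoef6 0 z (velocity z 1 [::])
   + 2 * z 0 i_K ^+ 2).

Definition torsion z :=
  (2 * torsion3 z - (2 * z 0 i_a + 1) * torsion4 z + z 0 i_a * torsion5 z
   - torsion6 z) / 3.

Lemma coefE z :
  ((coef 0 0 z = z 0 i_a1) * (coef 0 1 z = z 0 i_a2) * (coef 0 2 z = 0)) *
  ((coef 1 0 z = z 0 i_a11) * (coef 1 1 z = z 0 i_a12) * (coef 1 2 z = z 0 i_a1)) *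
  ((coef 2 0 z = z 0 i_a12) * (coef 2 1 z = z 0 i_a22) * (coef 2 2 z = z 0 i_a2)) *
  ((coef 3 0 z = z 0 i_a111) *
   (coef 3 1 z = z 0 i_a112 + 2 / 3 * z 0 i_a1 * z 0 i_K) *
   (coef 3 2 z = 2 * z 0 i_a11)) *
  ((coef 4 0 z = z 0 i_a112 - 1 / 3 * z 0 i_a1 * z 0 i_K) *
   (coef 4 1 z = z 0 i_a122 + 1 / 3 * z 0 i_a2 * z 0 i_K) *
   (coef 4 2 z = 2 * z 0 i_a12)) *
  ((coef 5 0 z = z 0 i_a122 - 2 / 3 * z 0 i_a2 * z 0 i_K) *
   (coef 5 1 z = z 0 i_a222) * (coef 5 2 z = 2 * z 0 i_a22)) *
  (coef 6 2 z = 2 * z 0 i_K).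
Proof. by []. Qed.

Lemma inord11 k (ltk : (k < 11)%N) : @inord 10 k = Ordinal ltk.
Proof. by apply/val_inj; rewrite /= inordK. Qed.

(** On the first two rows, the equations j = 3, 4, 5 equate mixed derivatives of the a_ijk up to
    torsion. Substituted in j = 6, they leave [y1] with the invertible coefficient 3, up to the
    factor a - a^2, so [x1], [y2], [y3], [y4] stay free. The pairs involving theta fix the last
    row. *)
Lemma frame_admissibleP z x1 x2 x3 x4 y1 y2 y3 y4 t1 t2 t3 t4 : web_domain z ->
  admissible S z (frame_matrix z
    [:: [:: x1; x2; x3; x4]; [:: y1; y2; y3; y4]; [:: t1; t2; t3; t4]]) <->
  [/\ x2 = y1 - torsion3 z, x3 = y2 - torsion4 z, x4 = y3 - torsion5 z &
      y1 = (z 0 i_a + 1) * y2 - z 0 i_a * y3 + torsion z] /\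
  [/\ t1 = 3 * z 0 i_a111, t2 = 3 * z 0 i_a112,
      t3 = 3 * z 0 i_a122 & t4 = 3 * z 0 i_a222].
Proof.
move=> zD; set B := frame_matrix z _.
have z0 := domain_neq0 zD.
have B1 : lsubmx B = 1%:M by rewrite row_mxKl.
have b0 : row o0 (rsubmx B) = velocity z 0 [:: x1; x2; x3; x4].
  by rewrite row_mxKr rowK.
have b1 : row o1 (rsubmx B) = velocity z 1 [:: y1; y2; y3; y4].
  by rewrite row_mxKr rowK.
have b2 : row o2 (rsubmx B) = velocity z 2 [:: t1; t2; t3; t4].
  by rewrite row_mxKr rowK.
have P := integral_elementP zD B1; move: P; rewrite /= b0 b1 b2 => P.
have [d00 d01] := dcoef6_velocity 0 x1 x2 x3 x4 zD.
have [d10 d11] := dcoef6_velocity 1 y1 y2 y3 y4 zD.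
have sub0 x y c e : e = 0 -> x - y = c * e -> x = y :> K.
  by move=> ->; rewrite mulr0 => /eqP; rewrite subr_eq0 => /eqP.
split=> [[_ /P BI]|[[Ex2 Ex3 Ex4 Ey1] [Et1 Et2 Et3 Et4]]].
- have [_ [e31 e32 e33]] := BI (@Ordinal 7 3 isT).
  have [_ [e41 _ e43]] := BI (@Ordinal 7 4 isT).
  have [_ [e51 _ e53]] := BI (@Ordinal 7 5 isT).
  have [_ [e61 _ _]] := BI (@Ordinal 7 6 isT).
  move: e31 e32 e33 e41 e43 e51 e53 e61.
  rewrite /dcoef /= d01 d10 !mxE /= !coefE => e31 e32 e33 e41 e43 e51 e53 e61.
  have Ex2 : x2 = y1 - torsion3 z by apply: (sub0 _ _ 1 _ e31); rewrite /torsion3; ring.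
  have Ex3 : x3 = y2 - torsion4 z by apply: (sub0 _ _ 1 _ e41); rewrite /torsion4; ring.
  have Ex4 : x4 = y3 - torsion5 z by apply: (sub0 _ _ 1 _ e51); rewrite /torsion5; ring.
  split; split=> //.
  (* After substitution [y1] has coefficient 3 / (a - a^2) here; the multiplier is its inverse. *)
  + apply: (sub0 _ _ ((z 0 i_a - z 0 i_a ^+ 2) / 3) _ e61).
    by rewrite Ex2 Ex3 Ex4 /torsion /torsion6; field.
  + by apply: (sub0 _ _ (- 1) _ e32); ring.
  + by apply: (sub0 _ _ (- 1) _ e33); field.
  + by apply: (sub0 _ _ (- 1) _ e43); field.
  + by apply: (sub0 _ _ (- 1) _ e53); ring.
split=> //; apply/P => j.
(* The theta row is the Euler direction, so for K the pairs with theta reduce to weight 3: 2 K_i - 3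
   K_i + K_i = 0. *)
have E : euler_direction z (velocity z 2 [:: t1; t2; t3; t4]).
  by rewrite /euler_direction !mxE /= !coefE.
have [dE0 dE1] := dcoef6_euler zD E.
case: j => -[|[|[|[|[|[|[|//]]]]]]] ltj; rewrite inord11 /dcoef /= ?d01 ?d10 ?d00 ?d11
  ?dE0 ?dE1 !mxE /=; split=> //; rewrite !coefE ?Ex2 ?Ex3 ?Ex4 ?Et1 ?Et2 ?Et3 ?Et4
  ?Ey1 /torsion /torsion3 /torsion4 /torsion5 /torsion6; split; by field.
Qed.

End Admissible.

Local Opaque dcoef6.

Lemma ord3P (P : 'I_3 -> Prop) :
  P (@Ordinal 3 0 isT) -> P (@Ordinal 3 1 isT) -> P (@Ordinal 3 2 isT) ->
  forall i, P i.
Proof.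
by move=> P0 P1 P2 [[|[|[|//]]] lti]; [move: P0|move: P1|move: P2];
  congr P; exact/val_inj.
Qed.

(** * The affine space of admissible integral elements *)

Section Solutions.
Context {K : numFieldType}.
Implicit Types (z w v : 'rV[K]_11) (P : 'rV[K]_4).
Notation S := (linearizable_web_system K).
Notation o0 := (@Ordinal 3 0 isT).
Notation o1 := (@Ordinal 3 1 isT).
Notation o2 := (@Ordinal 3 2 isT).
Notation par P k := (P 0 (@Ordinal 4 k isT)).

(** The parameters are the derivative of a_111 along the first basis vector and those of a_112,
    a_122, a_222 along the second. *)
Definition solution z P :=
  let y1 := (z 0 i_a + 1) * par P 1 - z 0 i_a * par P 2 + torsion z in
  frame_matrix z
    [:: [:: par P 0; y1 - torsion3 z; par P 1 - torsion4 z; par P 2 - torsion5 z];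
        [:: y1; par P 1; par P 2; par P 3];
        [:: 3 * z 0 i_a111; 3 * z 0 i_a112; 3 * z 0 i_a122; 3 * z 0 i_a222]].

Lemma admissibleP z (B : 'M[K]_(3, 3 + 11)) : web_domain z ->
  admissible S z B <-> exists P, B = solution z P.
Proof.
move=> zD; split=> [BA|[P ->]]; last exact/frame_admissibleP.
have [B1 BI] := BA.
pose q k := [:: rsubmx B k i_a111; rsubmx B k i_a112;
                rsubmx B k i_a122; rsubmx B k i_a222].
(* The equations Theta_j = 0 force every velocity component except the last four. *)
have BE : B = frame_matrix z [:: q o0; q o1; q o2].
  rewrite -[LHS](hsubmxK B) B1; congr row_mx.
  have E := (integral_elementP zD B1).1 BI.
  apply/matrixP => k j; move: j k.
  have e0 := E (@Ordinal 7 0 isT); have e1 := E (@Ordinal 7 1 isT).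
  have e2 := E (@Ordinal 7 2 isT); have e3 := E (@Ordinal 7 3 isT).
  have e4 := E (@Ordinal 7 4 isT); have e5 := E (@Ordinal 7 5 isT).
  have e6 := E (@Ordinal 7 6 isT).
  move: e0.1 e1.1 e2.1 e3.1 e4.1 e5.1 e6.1; rewrite /= !inord11 ![row _ _ _ _]mxE.
  move=> f0 f1 f2 f3 f4 f5 f6.
  by apply: ord11P; apply: ord3P; rewrite [RHS]mxE [RHS]mxE //=;
    [case: f0|case: f0|case: f0|case: f1|case: f1|case: f1|case: f2|case: f2|case: f2|
     case: f3|case: f3|case: f3|case: f4|case: f4|case: f4|case: f5|case: f5|case: f5|
     case: f6|case: f6|case: f6].
move: BA; rewrite {1}BE => /(frame_admissibleP _ _ _ _ _ _ _ _ _ _ _ _ zD).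
move=> [[e02 e03 e04 e11] [e21 e22 e23 e24]].
exists (\row_k nth 0 [:: rsubmx B o0 i_a111; rsubmx B o1 i_a112;
                         rsubmx B o1 i_a122; rsubmx B o1 i_a222] k).
rewrite {1}BE /solution ![(\row_k _) _ _]mxE /= -e11.
by rewrite /q e02 e03 e04 e21 e22 e23 e24.
Qed.

(** The homogeneous part of [solution]. Missing entries default to 0, so the theta row vanishes. *)
Definition variation z P : 'M[K]_(3, 3 + 11) :=
  let y1 := (z 0 i_a + 1) * par P 1 - z 0 i_a * par P 2 in
  row_mx 0 (\matrix_(k < 3, j < 11) nth 0 (nseq 7 0 ++ nth [::]
    [:: [:: par P 0; y1; par P 1; par P 2]; [:: y1; par P 1; par P 2; par P 3]] k) j).

Lemma solutionE z P : solution z P = solution z 0 + variation z P.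
Proof.
rewrite /solution /frame_matrix /variation add_row_mx addr0; congr row_mx.
apply/matrixP => k j; move: j k; apply: ord11P; apply: ord3P; rewrite !mxE /=; ring.
Qed.

Lemma variation_linear z : linear (variation z).
Proof.
move=> c P Q; rewrite /variation scale_row_mx add_row_mx scaler0 addr0; congr row_mx.
apply/matrixP => k j; move: j k; apply: ord11P; apply: ord3P; rewrite !mxE /=; ring.
Qed.

Lemma variation_inj z P : variation z P = 0 -> P = 0.
Proof.
move=> /matrixP V0.
have E k j (ltk : (k < 3)%N) (ltj : (j < 11)%N) :=
  V0 (Ordinal ltk) (rshift 3 (Ordinal ltj)).
apply/rowP => -[[|[|[|[|//]]]] ltk]; rewrite [RHS]mxE.
- have := E 0%N 7%N isT isT; rewrite row_mxEr !mxE /= => <-; congr (P 0 _); exact/val_inj.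
- have := E 1%N 8%N isT isT; rewrite row_mxEr !mxE /= => <-; congr (P 0 _); exact/val_inj.
- have := E 1%N 9%N isT isT; rewrite row_mxEr !mxE /= => <-; congr (P 0 _); exact/val_inj.
- have := E 1%N 10%N isT isT; rewrite row_mxEr !mxE /= => <-; congr (P 0 _); exact/val_inj.
Qed.

(** [solution] is affine and injective in four parameters; the image of [variation] is the direction
    space. *)
Lemma web_integral_elements_dim z : web_domain z -> integral_elements_dim S z 4.
Proof.
move=> zD.
pose linM := GRing.isLinear.Build _ _ _ _ _ (@variation_linear z).
pose f : {linear 'rV[K]_4 -> 'M[K]_(3, 3 + 11)} := HB.pack (variation z) linM.
have fE P : linfun f P = variation z P by exact: (lfunE f P).
exists (solution z 0), (limg (linfun f)); split.
  rewrite limg_dim_eq ?dimvf ?dim_matrix ?mul1n //.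
  apply/eqP; rewrite -subv0; apply/subvP => P; rewrite memv_cap memvf /= memv_ker.
  by rewrite [linfun _ _]fE => /eqP /variation_inj ->; exact: mem0v.
move=> B; split=> [/(admissibleP _ zD)[P ->]|/memv_imgP[P _]].
  by apply/memv_imgP; exists P; rewrite ?memvf// fE solutionE addrC addKr.
rewrite fE => BE; apply/(admissibleP _ zD); exists P.
by rewrite solutionE -BE addrC subrK.
Qed.

End Solutions.

(** * Polar ranks and Cartan characters *)

Section Characters.
Context {K : numFieldType}.
Implicit Types (z w v : 'rV[K]_11).
Notation S := (linearizable_web_system K).
Notation o0 := (@Ordinal 3 0 isT).
Notation o1 := (@Ordinal 3 1 isT).
Notation o2 := (@Ordinal 3 2 isT).

Lemma theta_kernel z (x : 'rV[K]_(3 + 11)) : lsubmx x = 0 ->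
  (forall j, eval1 (pfaffian_form S j z) x = 0) -> free_direction (rsubmx x).
Proof.
move=> x0 th; have E (j : 'I_7) : rsubmx x 0 (@inord 10 j) = 0.
  by have := th j; rewrite eval_theta x0 !mxE !mulr0 !addr0 subr0.
have := (E (@Ordinal 7 0 isT), E (@Ordinal 7 1 isT), E (@Ordinal 7 2 isT),
  E (@Ordinal 7 3 isT), E (@Ordinal 7 4 isT), E (@Ordinal 7 5 isT),
  E (@Ordinal 7 6 isT)).
by rewrite /= !inord11 => -[[[[[[? ?] ?] ?] ?] ?] ?].
Qed.

Lemma polar_rank0_min z : (7 <= polar_rank S z (0 : 'M[K]_(0, 3 + 11)))%N.
Proof.
rewrite -(leq_add2r 7); pose Q : 'M[K]_(7 + 4, 4) := col_mx 0 1%:M.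
(* [P] reads off the three base components and the four third-order ones. They determine a common
   zero of the Theta_j, so the kernel has dimension at most 7 = 14 - 7. *)
pose P : 'M[K]_(3 + 11, 3 + 4) := block_mx 1%:M 0 0 Q.
apply: (mxrank_ge_inj (P := P)) => x /polar_equations_ker Ax.
rewrite -[in x *m P](hsubmxK x) mul_row_block mulmx1 !mulmx0 addr0 add0r.
rewrite -[0]row_mx0 => /eq_row_mx[x0 xQ].
have [[f0 f1 f2] [f3 f4 f5 f6]] := theta_kernel x0 (fun j => (Ax j).1).
have QE (v : 'rV[K]_(7 + 4)) : v *m Q = rsubmx v.
  by rewrite -[in LHS](hsubmxK v) mul_row_col mulmx0 mulmx1 add0r.
have w0 : rsubmx (rsubmx x : 'rV_(7 + 4)) = 0.
  by rewrite -QE.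
have w0E k (ltk : (k < 4)%N) (lt7k : (7 + k < 11)%N) : rsubmx x 0 (Ordinal lt7k) = 0.
  have := congr1 (fun M : 'rV_4 => M 0 (Ordinal ltk)) w0; rewrite [LHS]mxE [RHS]mxE.
  by move=> <-; congr (rsubmx x 0 _); exact/val_inj.
rewrite -[x]hsubmxK x0; apply/eqP; rewrite -row_mx0; apply/eqP; congr row_mx.
apply/rowP; apply: ord11P; rewrite [RHS]mxE //.
- exact: (w0E 0%N).
- exact: (w0E 1%N).
- exact: (w0E 2%N).
- exact: (w0E 3%N).
Qed.

(* The three factors of the determinant vanish when the direction om1 = 1,
   om2 = y is tangent to the foliations X_2, X_3, X_4 respectively. *)
Lemma polar_rank_min z k (B : 'M[K]_(3, 3 + 11)) (F : 'M[K]_(k, 3)) i y :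
  web_domain z -> lsubmx B = 1%:M -> row i F = \row_j nth 0 [:: 1; y; 0] j ->
  y * (y + 1) * (y + z 0 i_a) != 0 -> (11 <= polar_rank S z (F *m B))%N.
Proof.
move=> zD B1 Fi y0; rewrite -(leq_add2r 3).
(* [P] reads off the base components: a polar vector with zero base part must vanish, which bounds
   the polar space by dimension 3. *)
pose P : 'M[K]_(3 + 11, 3) := col_mx 1%:M 0.
apply: (mxrank_ge_inj (P := P)) => x /polar_equations_ker Ax.
rewrite -[in x *m P](hsubmxK x) mul_row_col mulmx1 mulmx0 addr0 => x0.
have free := theta_kernel x0 (fun j => (Ax j).1).
have [dE0 dE1] := dcoef6_free zD free.
have [[f0 f1 f2] [f3 f4 f5 f6]] := free.
have Bi : lsubmx (row i (F *m B)) = \row_j nth 0 [:: 1; y; 0] j.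
  by rewrite row_mul -[B]hsubmxK B1 mul_mx_row row_mxKl mulmx1.
have D (j : 'I_7) : dcoef j 0 z (rsubmx x) + dcoef j 1 z (rsubmx x) * y = 0.
  have := (Ax j).2 i; rewrite eval_dtheta // Bi x0 !mxE /= => <-; ring.
have := D (@Ordinal 7 6 isT); have := D (@Ordinal 7 5 isT).
have := D (@Ordinal 7 4 isT); have := D (@Ordinal 7 3 isT).
rewrite /dcoef /= dE0 dE1 ?f1 ?f2 ?f6 !mulr0 !addr0 !mulr0 !addr0 !subr0.
move=> e3 e4 e5 e6.
have z0 := domain_neq0 zD.
set w7 := rsubmx x 0 i_a111 in e3 e6; set w8 := rsubmx x 0 i_a112 in e3 e4 e6.
set w9 := rsubmx x 0 i_a122 in e4 e5 e6; set w10 := rsubmx x 0 i_a222 in e5 e6.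
(* The equations j = 5, 4, 3 express [w9], [w8], [w7] through [w10]; then j = 6 is the determinant
   times [w10], up to a nonzero factor. *)
have E9 : w9 = - w10 * y by apply/eqP; rewrite mulNr -addr_eq0 e5.
have E8 : w8 = w10 * y ^+ 2.
  by move/eqP: e4; rewrite addr_eq0 E9 => /eqP ->; ring.
have E7 : w7 = - w10 * y ^+ 3.
  by move/eqP: e3; rewrite addr_eq0 E8 => /eqP ->; ring.
have : 3 * (y * (y + 1) * (y + z 0 i_a)) * w10 = 0.
  by rewrite -[RHS](mulr0 (z 0 i_a - z 0 i_a ^+ 2)) -e6 E9 E8 E7; field.
have c0 : 3 * (y * (y + 1) * (y + z 0 i_a)) != 0 by rewrite mulf_neq0 ?pnatr_eq0.
move/eqP; rewrite mulf_eq0 (negbTE c0) => /eqP E10.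
rewrite E10 in E7 E8 E9; move: E7 E8 E9; rewrite oppr0 !mul0r => E7 E8 E9.
rewrite -[x]hsubmxK x0; apply/eqP; rewrite -row_mx0; apply/eqP; congr row_mx.
by apply/rowP; apply: ord11P; rewrite [RHS]mxE.
Qed.

(** The partial sums are 7 for k = 0, where only the Theta_j count, and 11 for k = 1 and 2, since
    one regular direction already attains the upper bound. *)
Lemma web_cartan_characters z : web_domain z ->
  cartan_characters S z (nth 0%N [:: 7; 4; 0; 0]%N).
Proof.
move=> zD; split=> [k ltk3|]; last by rewrite !big_ord_recl big_ord0.
have BA : admissible S z (solution z 0) by apply/(admissibleP _ zD); exists 0.
(* The value 1 works unless a = -1; then the value 2 gives 2 times 3 times 1. *)
have [y y0] : exists y, y * (y + 1) * (y + z 0 i_a) != 0.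
  have [a1|a1] := eqVneq (z 0 i_a) (- 1).
    by exists 2; rewrite a1 [X in X != 0](_ : _ = 6%:R) ?pnatr_eq0 //; ring.
  exists 1; rewrite mul1r; apply: mulf_neq0; first by rewrite -mulr2n pnatr_eq0.
  by rewrite addrC -[1]opprK subr_eq0.
have [->|[->|->]] : k = 0%N \/ k = 1%N \/ k = 2%N.
- by case: k ltk3 => [|[|[|//]]]; auto.
- rewrite big_ord1 /=; split=> [|B F _ _]; last exact: polar_rank0_max.
  exists (solution z 0), 0; rewrite mxrank0; split=> //.
  by apply/eqP; rewrite eqn_leq polar_rank0_max mul0mx polar_rank0_min.
- rewrite !big_ord_recl big_ord0 /=; split=> [|B F BA' _]; last exact: polar_rank_max.
  pose F : 'M[K]_(1, 3) := \row_j nth 0 [:: 1; y; 0] j.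
  exists (solution z 0), F; split=> //.
    rewrite rank_rV; suff -> : F != 0 by [].
    by apply/eqP => /rowP /(_ o0); rewrite !mxE /= => /eqP; rewrite oner_eq0.
  apply/eqP; rewrite eqn_leq polar_rank_max //.
  apply: (@polar_rank_min _ _ _ _ 0 y) => //; first by case: BA.
  by apply/rowP => j; rewrite !mxE.
- rewrite !big_ord_recl big_ord0 /=; split=> [|B F BA' _]; last exact: polar_rank_max.
  (* The regular direction is completed by the theta direction. *)
  pose F : 'M[K]_(2, 3) :=
    \matrix_(i, j) nth 0 (nth [::] [:: [:: 1; y; 0]; [:: 0; 0; 1]] i) j.
  exists (solution z 0), F; split=> //.
    apply/eqP; apply/row_freeP.
    exists (\matrix_(i, j) nth 0 (nth [::] [:: [:: 1; 0]; [:: 0; 0]; [:: 0; 1]] i) j).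
    apply/matrixP => -[[|[|//]] lti] [[|[|//]] ltj]; rewrite !mxE sum_ord3 !mxE /=; ring.
  apply/eqP; rewrite eqn_leq polar_rank_max //.
  apply: (@polar_rank_min _ _ _ _ ord0 y) => //; first by case: BA.
  by apply/rowP => j; rewrite !mxE.
Qed.

Theorem web_general_solution : general_solution_depends_on S 4 1.
Proof.
exists (nth 0%N [:: 7; 4; 0; 0]%N); split=> [z zD|].
  split; [exact: web_structure_closed|exact: web_cartan_characters|].
  by rewrite !big_ord_recl big_ord0 /=; exact: web_integral_elements_dim.
by split=> // -[|[|[|[|//]]]].
Qed.

End Characters.

(** * A linear web *)

Section Smooth.
Context {K : numFieldType} {V W : normedModType K}.

Lemma class_C_cst k (U : set V) (c : W) : class_C k U (cst c).
Proof.
elim: k c => [|k IH] c /=; first by move=> p _; exact: cst_continuous.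
split=> [p _|v]; first exact: differentiable_cst.
rewrite (_ : 'D_v (cst c) = cst 0) //.
by apply/funext => p; rewrite derive_cst.
Qed.

(** Each first directional derivative is a constant function, which is of every class. *)
Lemma smooth_diff_cst (U : set V) (f : V -> W) (g : V -> W) :
  (forall p, differentiable f p) -> (forall p v, 'd f p v = g v) -> smooth U f.
Proof.
move=> df dfE -[|k] /=; first by move=> p _; exact: differentiable_continuous.
split=> [p _|v]; first exact: df.
rewrite (_ : 'D_v f = cst (g v)); first exact: class_C_cst.
by apply/funext => p; rewrite deriveE // dfE.
Qed.

End Smooth.

Lemma smooth_id (K : numFieldType) (V : normedModType K) (U : set V) :
  smooth U (@id V).
Proof.
apply: (@smooth_diff_cst _ _ _ _ _ id) => [p|p v].
  by have [] := is_diff_id p.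
by have [_ ->] := is_diff_id p.
Qed.

(** * The web of four families of parallel lines *)

Section Parallel.
Context {K : numFieldType}.
Implicit Types (a b c : K) (p q v : plane K).
(** Lines, hence the level sets and the plane, inherit connectedness from the scalar field; this is
    where the real and complex cases differ. *)
Hypothesis K_connected : connected [set: K].

Definition linear_form a b p : K := a * p 0 0 + b * p 0 1.

Lemma linear_formD a b p q :
  linear_form a b (p + q) = linear_form a b p + linear_form a b q.
Proof. by rewrite /linear_form !mxE; ring. Qed.

Lemma has_diff_linear_form a b p v :
  has_diff p v (linear_form a b) (linear_form a b v).
Proof.
have := has_diffD (has_diffM (has_diff_cst p v a) (has_diff_coord p v 0))
                  (has_diffM (has_diff_cst p v b) (has_diff_coord p v 1)).
by rewrite !mulr0 !addr0.
Qed.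

(** Spans the kernel of [linear_form a b] when a or b is nonzero; another linear form takes on it
    the value of a 2 by 2 determinant. *)
Definition direction a b : plane K := \row_j nth 0 [:: - b; a] j.

Lemma linear_form_direction a b a' b' t :
  linear_form a' b' (t *: direction a b) = t * (a * b' - a' * b).
Proof. by rewrite /linear_form !mxE /=; ring. Qed.

Lemma linear_form_eq0 a b v : (a != 0) || (b != 0) ->
  linear_form a b v = 0 -> exists t, v = t *: direction a b.
Proof.
move=> ab0 v0; have [a0|a0] := eqVneq a 0.
  have b0 : b != 0 by move: ab0; rewrite a0 eqxx.
  exists (- v 0 0 / b); apply/rowP => -[[|[|//]] ltj]; rewrite !mxE /=.
    rewrite [RHS](_ : _ = v 0 0); last by field.
    by congr (v 0 _); exact: val_inj.
  move/eqP: v0; rewrite /linear_form a0 mul0r add0r mulf_eq0 (negbTE b0) => /eqP v0.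
  by rewrite mulr0 -v0; congr (v 0 _); exact: val_inj.
exists (v 0 1 / a); apply/rowP => -[[|[|//]] ltj]; rewrite !mxE /=.
  apply: (mulfI a0); rewrite [RHS](_ : _ = - (b * v 0 1)); last by field.
  move/eqP: v0; rewrite addr_eq0 => /eqP <-.
  by congr (_ * v 0 _); exact: val_inj.
rewrite -mulrA mulVf // mulr1; congr (v 0 _); exact: val_inj.
Qed.

Definition line_param p v (t : K) : plane K := p + t *: v.

Lemma line_param_continuous p v : continuous (line_param p v).
Proof. by move=> t; exact: (cvgD (cvg_cst p) (@scalel_continuous _ _ v t)). Qed.

Lemma connected_line p v : connected (range (line_param p v)).
Proof.
apply: connected_continuous_connected => //.
exact/continuous_subspaceT/line_param_continuous.
Qed.

(** The plane is the union of the lines through the origin. *)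
Lemma connected_plane : connected [set: plane K].
Proof.
rewrite (_ : setT = \bigcup_(v in [set: plane K]) range (line_param 0 v)).
  apply: bigcup_connected => [|v _]; last exact: connected_line.
  by exists 0 => v _; exists 0 => //; rewrite /line_param scale0r addr0.
apply/seteqP; split=> // v _; exists v => //; exists 1 => //.
by rewrite /line_param scale1r add0r.
Qed.

Lemma connected_level_set a b c : (a != 0) || (b != 0) ->
  connected (setT `&` linear_form a b @^-1` [set c]).
Proof.
move=> ab0; rewrite setTI.
have [[p pc]|none] := pselect (exists p, linear_form a b p = c); last first.
  rewrite (_ : _ @^-1` _ = set0); first exact: connected0.
  by apply/seteqP; split=> // p pc; apply: none; exists p.
rewrite (_ : _ @^-1` _ = range (line_param p (direction a b))).
  exact: connected_line.
apply/seteqP; split=> [q qc|_ [t _ <-]].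
  have [t qpt] : exists t, q - p = t *: direction a b.
    apply: linear_form_eq0 => //; apply: (addIr (linear_form a b p)).
    by rewrite -linear_formD subrK add0r pc.
  by exists t => //; rewrite /line_param -qpt addrC subrK.
by rewrite /= linear_formD linear_form_direction subrr mulr0 addr0.
Qed.

Definition parallel_foliation a b : foliation_atlas K :=
  [set x | x = (setT, linear_form a b)].

Lemma is_foliation_parallel a b : (a != 0) || (b != 0) ->
  is_foliation setT (parallel_foliation a b).
Proof.
move=> ab0; have du p v : 'd (linear_form a b) p v = linear_form a b v.
  exact: (has_diff_linear_form a b p v).2.
split=> [U u [-> ->]|p _|U u U' u' p [-> ->] [-> ->] //].
- split=> // [||p _|c].
  + exact: openT.
  + apply: (@smooth_diff_cst _ (plane K) K _ _ (linear_form a b)) => // p.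
    exact: (has_diff_linear_form a b p 0).1.
  + have [a0|a0] := eqVneq a 0.
      exists (delta_mx 0 1); rewrite du /linear_form !mxE /= mulr0 add0r mulr1.
      by move: ab0; rewrite a0 eqxx.
    by exists (delta_mx 0 0); rewrite du /linear_form !mxE /= mulr0 addr0 mulr1.
  + exact: connected_level_set.
- by exists setT, (linear_form a b).
Qed.

Lemma leaf_parallel a b p :
  leaf (parallel_foliation a b) p = [set q | linear_form a b q = linear_form a b p].
Proof.
apply/seteqP; split=> q /=.
  elim=> {p q} [p q [U [u [[-> ->] _ _ ->]]] //|p //|p q r _ pq _ qr].
  by rewrite qr.
by move=> qp; apply: rt_step; exists setT, (linear_form a b).
Qed.

Lemma leaf_parallel_line a b p : (a != 0) || (b != 0) ->
  leaf (parallel_foliation a b) p `<=` straight_line p (direction a b).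
Proof.
move=> ab0; rewrite leaf_parallel => q /= qp.
have [t qpt] : exists t, q - p = t *: direction a b.
  apply: linear_form_eq0 => //; apply: (addIr (linear_form a b p)).
  by rewrite -linear_formD subrK add0r.
by exists t; rewrite -qpt addrC subrK.
Qed.

Lemma direction_neq0 a b : (a != 0) || (b != 0) -> direction a b != 0.
Proof.
apply: contraTN => /eqP/rowP d0; rewrite negb_or !negbK.
have := d0 0; have := d0 1; rewrite !mxE /= => -> /eqP.
by rewrite oppr_eq0 eqxx => ->.
Qed.

(** The leaves are the level lines of x, y, x + y and x + 2 y. Natural numbers as normals let
    transversality be decided by computation and carried to K by characteristic zero. *)
Definition normal_x (c : nat) : nat := nth 0%N [:: 1; 0; 1; 1]%N c.
Definition normal_y (c : nat) : nat := nth 0%N [:: 0; 1; 1; 2]%N c.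

Definition parallel_web (c : 'I_4) : foliation_atlas K :=
  parallel_foliation (normal_x c)%:R (normal_y c)%:R.

Lemma normal_neq0 (c : 'I_4) : ((normal_x c)%:R != 0 :> K) || ((normal_y c)%:R != 0 :> K).
Proof. by rewrite !pnatr_eq0; case: c => -[|[|[|[|//]]]]. Qed.

Lemma normal_transversal (c c' : 'I_4) : c != c' ->
  (normal_x c)%:R * (normal_y c')%:R - (normal_x c')%:R * (normal_y c)%:R != 0 :> K.
Proof.
rewrite subr_eq0 -!natrM eqr_nat.
by case: c c' => -[|[|[|[|//]]]] ? [[|[|[|[|//]]]]].
Qed.

Lemma four_web_parallel : four_web setT parallel_web.
Proof.
split=> [|c|c c' p cc' _|c c' p p' cc' _ _ q q' []].
- split; [exact: openT|exact: connected_plane|by exists 0].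
- exact/is_foliation_parallel/normal_neq0.
(* [v] is tangent to the family [c]; its value under the form of [c'] is the nonzero determinant, so
   the tangent lines differ. *)
- pose v := direction (normal_x c)%:R (normal_y c)%:R : plane K.
  have tgE (c0 : 'I_4) : tangent_line (parallel_web c0) p v <->
      linear_form (normal_x c0)%:R (normal_y c0)%:R v = 0.
    rewrite -(has_diff_linear_form _ _ p v).2.
    split=> [[U [u [[-> ->] _ //]]]|v0].
    by exists setT, (linear_form (normal_x c0)%:R (normal_y c0)%:R).
  have dirE (c0 : 'I_4) : linear_form (normal_x c0)%:R (normal_y c0)%:R v =
      (normal_x c)%:R * (normal_y c0)%:R - (normal_x c0)%:R * (normal_y c)%:R.
    by rewrite -[v]scale1r linear_form_direction mul1r.
  move=> tcc'; have : tangent_line (parallel_web c) p v by apply/tgE; rewrite dirE subrr.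
  by rewrite tcc' => /tgE; rewrite dirE; apply/eqP/normal_transversal.
(* Two common points differ by [t] times the direction of [c]. The form of [c'] vanishes on this
   difference and equals [t] times the determinant, so t = 0. *)
- rewrite !leaf_parallel /= => qp qp' [q'p q'p'].
  have [t qq't] : exists t, q - q' = t *: direction (normal_x c)%:R (normal_y c)%:R.
    apply: linear_form_eq0; first exact: normal_neq0.
    apply: (addIr (linear_form (normal_x c)%:R (normal_y c)%:R q')).
    by rewrite -linear_formD subrK add0r qp q'p.
  have := linear_form_direction (normal_x c)%:R (normal_y c)%:R
     (normal_x c')%:R (normal_y c')%:R t.
  rewrite -qq't; have -> : linear_form (normal_x c')%:R (normal_y c')%:R (q - q') = 0.
    apply: (addIr (linear_form (normal_x c')%:R (normal_y c')%:R q')).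
    by rewrite -linear_formD subrK add0r qp' q'p'.
  move/esym/eqP; rewrite mulf_eq0 (negbTE (normal_transversal cc')) orbF => /eqP t0.
  by apply/eqP; rewrite -subr_eq0 qq't t0 scale0r.
Qed.

Lemma linearizable_parallel : linearizable setT parallel_web.
Proof.
exists setT, parallel_web; split.
  split=> [|c p _]; first exact: four_web_parallel.
  exists (direction (normal_x c)%:R (normal_y c)%:R).
    exact/direction_neq0/normal_neq0.
  exact/leaf_parallel_line/normal_neq0.
exists id => [|c p _]; last by rewrite image_id.
split; [exact: smooth_id| |by exists id; split; [exact: smooth_id|]].
by split=> // [p q _ _ //|p _]; exists p.
Qed.

End Parallel.

(** * Connectedness of the scalar fields, and conclusion *)

Lemma connected_real (R : realType) : connected [set: R].
Proof. exact/connected_intervalP. Qed.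

(** A positive element of [R[i]] is real, and the norm of an embedded real is its embedded absolute
    value, so the real estimate transfers. *)
Lemma real_complex_continuous (R : realType) (C := R[i] : numFieldType) :
  continuous (fun t : R => t%:C%C : C).
Proof.
move=> x; apply/(@cvgrPdist_lt C C) => e e0.
have [eI e'0] : e = (complex.Re e)%:C%C /\ 0 < complex.Re e.
  move: e0; rewrite ltcE => /andP[/eqP]; case: e => a b /= -> a0.
  by split.
near=> y; rewrite -rmorphB normc_def /= expr0n addr0 sqrtr_sqr eI ltcR.
near: y; exact: cvgr_dist_lt (@cvg_id _ (nbhs x)) _ e'0.
Unshelve. all: by end_near.
Qed.

(** The complex numbers are the union of the real lines through 0, each a continuous image of
    [R]. *)
Lemma connected_complex (R : realType) (C := R[i] : numFieldType) :
  connected [set: C].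
Proof.
rewrite (_ : setT = \bigcup_(v in [set: C]) range (fun t : R => (t%:C%C : C) * v)).
  apply: bigcup_connected => [|v _].
    by exists 0 => v _; exists 0 => //; rewrite mul0r.
  apply: connected_continuous_connected; first exact: connected_real.
  apply/continuous_subspaceT => t; apply: cvgM; last exact: cvg_cst.
  exact: real_complex_continuous.
by apply/seteqP; split=> // v _; exists v => //; exists 1 => //; rewrite mul1r.
Qed.

Theorem proposition3 (R : realType) :
  ((exists (D : set (plane R)) (X : 'I_4 -> foliation_atlas R),
      four_web D X /\ linearizable D X) /\
   general_solution_depends_on (linearizable_web_system R) 4 1) /\
  ((exists (D : set (plane (complex R))) (X : 'I_4 -> foliation_atlas (complex R)),
      four_web D X /\ linearizable D X) /\
   general_solution_depends_on (linearizable_web_system (complex R)) 4 1).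
Proof.
have main (K : numFieldType) : connected [set: K] ->
    (exists (D : set (plane K)) (X : 'I_4 -> foliation_atlas K),
       four_web D X /\ linearizable D X) /\
    general_solution_depends_on (linearizable_web_system K) 4 1.
  move=> K_connected; split; last exact: web_general_solution.
  exists setT, (@parallel_web K).
  by split; [exact: four_web_parallel|exact: linearizable_parallel].
split; first exact: main (@connected_real R).
exact: main (@connected_complex R).
Qed.
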